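(* Suppose that $\mathfrak p=(p_d)_{d\ge1}$ and $\mathfrak q=(q_d)_{d\ge1}$, with $p_d,q_d\in\mathcal P_d(\mathbb R)$, are two sequences of polynomials with infinitesimal distributions $(\mu,\mu')$ and $(\nu,\nu')$, respectively. If $\mu\ne\delta_0$ and $\nu=\delta_1$, then the finite-free multiplicative convolution $\mathfrak p\boxtimes\mathfrak q=(p_d\boxtimes_d q_d)_{d\ge1}$ has infinitesimal distribution $(\gamma,\gamma')$, where $\gamma=\mu\boxtimes\nu$ and $$G_{\gamma'}=G_{\mu'}+G_{\nu'}(\theta_\mu)\cdot\theta_\mu'\qquad\text{with}\qquad\theta_\mu(z)=\frac{G_\mu(z)}{G_\mu(z)-1/z}.$$
   Context: $\delta_a$ is the Dirac mass at $a$. $\mathcal P_d(\mathbb R)$ is the set of monic real polynomials of degree $d$ with only real roots. For a monic real polynomial $p_d$ of degree $d$ with (complex) roots $\lambda_1,\dots,\lambda_d$ with multiplicity, $m_n(p_d)=\frac1d\sum_k\lambda_k^n$. Write $p_d(x)=\sum_{k=0}^d x^{d-k}(-1)^k\binom dk\mathsf e_k(p_d)$. The finite-free multiplicative convolution is $[p_d\boxtimes_d q_d](x)=\sum_{k=0}^d x^{d-k}(-1)^k\binom dk\,\mathsf e_k(p_d)\,\mathsf e_k(q_d)$ (real-rooted when, in addition, one of the factors has no negative roots). A sequence $\mathfrak p=(p_d)$ of monic polynomials, $\deg p_d=d$, has infinitesimal distribution $(\mu,\mu')$ if $\mu$ is a probability distribution on $\mathbb R$ with finite moments $m_n(\mu)$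 of all orders, $m_n(p_d)\to m_n(\mu)$ for all $n\ge0$, the limits $m_n'(\mathfrak p)=\lim_{d\to\infty}d\,(m_n(p_d)-m_n(\mu))$ exist for all $n\ge1$, and $\mu':\mathbb R[x]\to\mathbb R$ is the linear functional with $\mu'(1)=0$, $\mu'(x^n)=m_n'(\mathfrak p)$. $NC(n)$ is the set of non-crossing partitions of $\{1,\dots,n\}$; for a sequence $(u_n)$, $u_\pi=\prod_{V\in\pi}u_{|V|}$; $Kr(\pi)\in NC(n)$ is the Kreweras complement of $\pi$ (the partition into cycles of $\pi^{-1}(1,2,\dots,n)$, with $\pi$ viewed as the permutation whose cycles are its blocks in increasing order). Free cumulants $r_n(\mu)$ are defined recursively by $m_n(\mu)=\sum_{\pi\in NC(n)}r_\pi(\mu)$. Throughout, only distributions determined by their moments are considered; for $\nu$ supported on $[0,\infty)$, $\mu\boxtimes\nu$ is the probability measure with $r_n(\mu\boxtimes\nu)=\sum_{\pi\in NC(n)}r_\pi(\mu)\,r_{Kr(\pi)}(\nu)$ for all $n\ge1$ (so $\mu\boxtimes\delta_1=\mu$). $G_\mu(z)=\sum_{n\ge0}m_n(\mu)z^{-n-1}$ and, for a linear functional $\mu'$ on $\mathbb R[x]$, $G_{\mu'}(z)=\sum_{n\ge0}\mu'(x^n)z^{-n-1}$ are formal power series in $z^{-1}$; the displayed identity, with composition and derivative, is one of formal (Laurent) series in $z^{-1}$. *)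

(* Defs.v *)
From HB Require Import structures.
From mathcomp Require Import all_boot all_order all_algebra all_fingroup.
From mathcomp Require Import complex zify.
From mathcomp Require Import all_classical all_reals all_analysis.

Set Implicit Arguments.
Unset Strict Implicit.
Unset Printing Implicit Defensive.

Import Order.TTheory GRing.Theory Num.Theory numFieldNormedType.Exports.

Local Open Scope classical_set_scope.
Local Open Scope ring_scope.

Section Polynomials.
Variable R : realType.
Implicit Types (p q : {poly R}) (d n k : nat).

Definition to_complex p : {poly R[i]} := map_poly (real_complex R) p.

Definition complex_roots p : seq R[i] :=
  sval (closed_field_poly_normal (to_complex p)).

Definition monic_of_degree d p : Prop := p \is monic /\ size p = d.+1.

Definition real_rooted d p : Prop :=
  monic_of_degree d p /\
  forall z : R[i], root (to_complex p) z -> z \is Num.real.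

(* The mean of the n-th powers of the complex roots is a real number (see
   [poly_momentE]); [complex.Re] only brings it back to the type R. *)
Definition poly_moment p n : R :=
  complex.Re ((\sum_(z <- complex_roots p) z ^+ n) / (size p).-1%:R).

(* p = \sum_k (-1)^k 'C(d, k) e_k 'X^(d - k) *)
Definition norm_coef d p k : R := (-1) ^+ k * p`_(d - k) / 'C(d, k)%:R.

Definition ffmul d p q : {poly R} :=
  \sum_(k < d.+1)
    ((-1) ^+ k * 'C(d, k)%:R * norm_coef d p k * norm_coef d q k) *: 'X^(d - k).

Lemma complex_rootsE p : p \is monic ->
  to_complex p = \prod_(z <- complex_roots p) ('X - z%:P).
Proof.
move=> pm; rewrite /complex_roots; case: closed_field_poly_normal => r /= ->.
by rewrite lead_coef_map /= (monicP pm) rmorph1 scale1r.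
Qed.

Lemma poly_momentE p n : p \is monic ->
  real_complex R (poly_moment p n) =
  (\sum_(z <- complex_roots p) z ^+ n) / (size p).-1%:R.
Proof.
move=> pm; rewrite /poly_moment; set m := (X in complex.Re X).
rewrite -[RHS]/m; suff: conjc m = m.
  case: m => a b [] /eqP; rewrite eq_sym -addr_eq0 -mulr2n mulrn_eq0 /=.
  by move=> /eqP ->.
rewrite /m rmorphM /= fmorphV rmorph_nat rmorph_sum /=; congr (_ / _).
under eq_bigr do rewrite rmorphXn /=.
rewrite -(big_map (@conjc R) xpredT (fun z => z ^+ n)).
apply: perm_big; apply: prod_XsubC_eq; rewrite big_map -complex_rootsE //.
transitivity (map_poly (@conjc R) (to_complex p)); last first.
  by rewrite /to_complex -map_poly_comp; apply: eq_map_poly => x; rewrite /= oppr0.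
rewrite complex_rootsE // rmorph_prod /=.
by apply: eq_bigr => z _; rewrite rmorphB /= map_polyX map_polyC.
Qed.

End Polynomials.

Section NonCrossing.
Variable n : nat.
Implicit Types P : {set {set 'I_n}}.

Definition noncrossing P : bool :=
  [forall V in P, forall W in P, forall a in V, forall b in W,
   forall c in V, forall d in W,
     [&& (a < b)%N, (b < c)%N & (c < d)%N] ==> (V == W)].

Definition NC : {set {set {set 'I_n}}} :=
  [set P | finset.partition P [set: 'I_n] && noncrossing P].

(* The permutation whose cycles are the blocks of P in increasing order:
   [enum V] lists V increasingly, and [next (enum V)] is the cyclic successor
   in that list. *)
Definition block_perm P : 'S_n :=
  odflt 1%g [pick s : 'S_n | [forall i, s i == next (enum (finset.pblock P i)) i]].

Lemma block_permE P i : finset.partition P [set: 'I_n] ->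
  block_perm P i = next (enum (finset.pblock P i)) i.
Proof.
move=> Ppart; rewrite /block_perm.
case/and3P: (Ppart) => /eqP covP triP _.
have inP j : j \in finset.pblock P j by rewrite mem_pblock covP inE.
pose f j := next (enum (finset.pblock P j)) j.
have fP j : finset.pblock P (f j) = finset.pblock P j.
  by apply: same_pblock => //; rewrite -mem_enum mem_next mem_enum.
have f_inj : injective f.
  move=> j k fjk; have pjk : finset.pblock P j = finset.pblock P k.
    by rewrite -fP fjk fP.
  apply: (can_inj (prev_next (enum_uniq (finset.pblock P k)))).
  by rewrite -[in LHS]pjk.
case: pickP => [s /forallP /(_ i) /eqP // | /(_ (perm f_inj)) /negP []].
by apply/forallP => j; rewrite permE.
Qed.

(* Cycles of pi^-1 o (1 2 ... n); products in 'S_n compose left to right. *)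
Definition kreweras P : {set {set 'I_n}} :=
  porbits (perm (@ordS_inj n) * (block_perm P)^-1)%g.

End NonCrossing.

Section FreeCumulants.
Variable R : comNzRingType.

Definition block_prod (u : nat -> R) n (P : {set {set 'I_n}}) : R :=
  \prod_(V in P) u #|V|.

(* The list [:: 0; r_1; ...; r_n] of free cumulants, where r_k is solved from
   m_k = \sum_(P in NC k) r_P by isolating the one-block partition. *)
Fixpoint free_cumulant_seq (m : nat -> R) n : seq R :=
  if n is k.+1 then
    let s := free_cumulant_seq m k in
    rcons s (m k.+1 - \sum_(P in NC k.+1 | P != [set [set: 'I_k.+1]]%SET)
                         block_prod (nth 0 s) P)
  else [:: 0].

Definition free_cumulant m n : R := nth 0 (free_cumulant_seq m n) n.

Lemma size_free_cumulant_seq m n : size (free_cumulant_seq m n) = n.+1.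
Proof. by elim: n => //= n IHn; rewrite size_rcons IHn. Qed.

Lemma nth_free_cumulant_seq m n k : (k <= n)%N ->
  nth 0 (free_cumulant_seq m n) k = free_cumulant m k.
Proof.
elim: n => [|n IHn]; first by rewrite leqn0 => /eqP ->.
rewrite leq_eqVlt ltnS => /predU1P [-> //|kn].
by rewrite /= nth_rcons size_free_cumulant_seq ltnS kn IHn.
Qed.

Lemma moment_free_cumulant m n : (0 < n)%N ->
  m n = \sum_(P in NC n) block_prod (free_cumulant m) P.
Proof.
case: n => // n _; set full := [set [set: 'I_n.+1]]%SET.
have fullNC : full \in NC n.+1.
  rewrite inE; apply/andP; split.
    rewrite /finset.partition /full finset.cover1 eqxx finset.trivIset1 /=.
    rewrite inE eq_sym -card_gt0 cardsT card_ord //.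
  apply/forall_inP => V /set1P ->; apply/forall_inP => W /set1P ->.
  by do 4 (apply/forall_inP => ? _); rewrite eqxx implybT.
rewrite (bigD1 full) //= {1}/block_prod big_set1 cardsT card_ord.
rewrite {1}/free_cumulant /= nth_rcons size_free_cumulant_seq ltnn eqxx.
rewrite -/full -addrA [X in _ + X](_ : _ = 0) ?addr0 //.
apply/eqP; rewrite addrC subr_eq0; apply/eqP.
apply: eq_bigr => P /andP []; rewrite inE => /andP [Ppart _] Pfull.
apply: eq_bigr => V VP; rewrite nth_free_cumulant_seq //.
rewrite -ltnS -[X in (_ < X)%N]card_ord -cardsT.
apply: proper_card; rewrite finset.properEneq finset.subsetT andbT.
apply: contra_neq Pfull => VT.
case/and3P: Ppart => /eqP covP triP P0.
apply/setP => W; rewrite inE; apply/idP/eqP => [WP|->]; last by rewrite -VT.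
apply/eqP; rewrite -VT; apply/negPn/negP => WV.
have := finset.trivIsetP triP W V WP VP WV.
rewrite VT -setI_eq0 finset.setIT => /eqP W0.
by move: P0; rewrite -W0 WP.
Qed.

End FreeCumulants.

Section Distributions.
Variable R : realType.
Notation distr := (probability (measurableTypeR R) R).
Implicit Types mu nu gamma : distr.

Definition finite_moments mu : Prop :=
  forall n, mu.-integrable setT (fun x : R => (x ^+ n)%:E).

Definition moment mu n : R := \int[mu]_(x in setT) (x ^+ n).

(* Measures are only specified on measurable sets. *)
Definition same_measure (mu nu : set (measurableTypeR R) -> \bar R) : Prop :=
  forall A, measurable A -> mu A = nu A.

Definition moment_determinate mu : Prop :=
  finite_moments mu /\
  forall nu, finite_moments nu -> (forall n, moment nu n = moment mu n) ->
    same_measure nu mu.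

Definition is_free_mul mu nu gamma : Prop :=
  [/\ moment_determinate mu, moment_determinate nu, moment_determinate gamma,
      nu [set x : R | x < 0] = 0%E
    & forall n, (0 < n)%N ->
        free_cumulant (moment gamma) n =
        \sum_(P in NC n) block_prod (free_cumulant (moment mu)) P
                       * block_prod (free_cumulant (moment nu)) (kreweras P)].

Definition has_infinitesimal_distribution
    (p : nat -> {poly R}) mu (mu' : {scalar {poly R}}) : Prop :=
  [/\ forall d, (0 < d)%N -> monic_of_degree d (p d),
      moment_determinate mu,
      forall n, poly_moment (p d) n @[d --> \oo] --> moment mu n,
      mu' 1 = 0
    & forall n, (0 < n)%N ->
        d%:R * (poly_moment (p d) n - moment mu n) @[d --> \oo] --> mu' 'X^n].

End Distributions.

Section Laurent.
Variable R : realType.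

(* [f k] is the coefficient of z^k, and only finitely many k > 0 have a nonzero
   coefficient.  Sum and opposite are those of functions; the product is [lmul]
   and not the pointwise product. *)
Implicit Types f g h : int -> R.

Definition is_laurent f : Prop := exists N : int, forall k, N < k -> f k = 0.

Definition lone : int -> R := fun k => (k == 0)%:R.

Definition zinv : int -> R := fun k => (k == -1)%:R.

(* For Laurent series only finitely many terms of the sum are nonzero. *)
Definition lmul f g : int -> R :=
  fun k => \sum_(i \in [set: int]) f i * g (k - i).

Definition linv f : int -> R :=
  xget 0 [set g | is_laurent g /\ lmul f g = lone].

Lemma lmulE f g (N M : int) n :
  (forall k, N < k -> f k = 0) -> (forall k, M < k -> g k = 0) ->
  lmul f g (N + M - n%:Z) = \sum_(i < n.+1) f (N - i%:Z) * g (M - (n - i)%N%:Z).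
Proof.
move=> fN gM; pose r := [seq N - i%:Z | i <- iota 0 n.+1].
have r_uniq : uniq r.
  by rewrite map_inj_uniq ?iota_uniq // => i j /addrI /oppr_inj [].
rewrite /lmul (fsbigE r) //; last first.
  move=> i _ ir; have [Ni|iN] := ltP N i; first by rewrite fN ?mul0r.
  rewrite gM ?mulr0 //; have [j ij] : exists j, i = N - Posz j.
    by exists `|N - i|%N; rewrite gez0_abs ?subr_ge0 // opprB addrC subrK.
  have : (n < j)%N.
    rewrite ltnNge; apply: contra ir => jn; rewrite ij.
    by apply/mapP; exists j => //; rewrite mem_iota add0n ltnS.
  by rewrite ij; lia.
rewrite big_map -[iota 0 n.+1]/(index_iota 0 n.+1) big_mkord.
apply: eq_big => [i|i _]; first by rewrite in_setT.
by congr (_ * g _); have := ltn_ord i; lia.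
Qed.

Lemma lmul_eq0 f g (N M : int) k :
  (forall k, N < k -> f k = 0) -> (forall k, M < k -> g k = 0) ->
  N + M < k -> lmul f g k = 0.
Proof.
move=> fN gM kNM; apply: fsbig1 => i _.
have [Ni|iN] := ltP N i; first by rewrite fN ?mul0r.
by rewrite gM ?mulr0 //; lia.
Qed.

Lemma laurent_top f : is_laurent f -> f <> 0 ->
  exists2 N : int, f N != 0 & forall k, N < k -> f k = 0.
Proof.
move=> [B fB] f0.
have exj : exists j, f (B - Posz j) != 0.
  apply: contrapT => /forallNP fj; apply: f0; apply/funext => k.
  have [/fB //|kB] := ltP B k.
  have := fj `|B - k|%N; move/negP; rewrite negbK => /eqP fk0; rewrite -[RHS]fk0.
  by congr f; lia.
case: (ex_minnP exj) => j fj jmin; exists (B - Posz j) => // k jk.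
have [/fB //|kB] := ltP B k; apply/eqP; apply: contraT => fk.
have := jmin `|B - k|%N; rewrite (_ : B - _ = k) ?fk; last lia.
by move=> /(_ isT); lia.
Qed.

Lemma linv_exists f : is_laurent f -> f <> 0 ->
  exists2 g, is_laurent g & lmul f g = lone.
Proof.
move=> fL f0; have [N fN0 fN] := laurent_top fL f0.
pose a i := f (N - Posz i).
pose bs := fix bs n : seq R := if n is k.+1 then
  rcons (bs k) (- (a 0%N)^-1 * \sum_(i < k.+1) a i.+1 * nth 0 (bs k) (k - i))
  else [:: (a 0%N)^-1].
have a0 : a 0%N != 0 by rewrite /a subr0.
have size_bs n : size (bs n) = n.+1 by elim: n => //= n IHn; rewrite size_rcons IHn.
pose b n := nth 0 (bs n) n.
have nth_bs n k : (k <= n)%N -> nth 0 (bs n) k = b k.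
  elim: n => [|n IHn]; first by rewrite leqn0 => /eqP ->.
  rewrite leq_eqVlt ltnS => /predU1P [-> //|kn].
  by rewrite /= nth_rcons size_bs ltnS kn IHn.
have bS n : a 0%N * b n.+1 = - \sum_(i < n.+1) a i.+1 * b (n - i)%N.
  rewrite {1}/b /= nth_rcons size_bs ltnn eqxx mulrA mulrN mulfV // mulN1r.
  by congr (- _); apply: eq_bigr => i _; rewrite nth_bs ?leq_subr.
pose g (k : int) : R := if - N < k then 0 else b `|- N - k|%N.
have gN k : - N < k -> g k = 0 by rewrite /g => ->.
exists g; first by exists (- N).
apply/funext => k; have [k0|k0] := ltP 0 k.
  by rewrite (lmul_eq0 fN gN) ?subrr // /lone gt_eqF.
have -> : k = N - N - Posz `|k|%N by lia.
rewrite (lmulE _ fN gN) /lone; move: `|k|%N => n.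
have gE m : g (- N - Posz m) = b m.
  by rewrite /g ifF; [congr b; lia|lia].
under eq_bigr do rewrite gE.
rewrite big_ord_recl subn0 -/(a 0%N); case: n => [|n].
  by rewrite big_ord0 addr0 subrr subr0 eqxx /b /= mulfV.
rewrite bS (_ : (_ == 0) = false); last lia.
by under [X in _ + X]eq_bigr do rewrite lift0 subSS; rewrite addNr.
Qed.

Lemma linvP f : is_laurent f -> f <> 0 ->
  is_laurent (linv f) /\ lmul f (linv f) = lone.
Proof.
move=> fL f0; have [g gL fg] := linv_exists fL f0.
by apply: (@xgetPex _ 0 [set g | is_laurent g /\ lmul f g = lone]); exists g.
Qed.

Lemma linv_unique f g : is_laurent f -> f <> 0 -> is_laurent g ->
  lmul f g = lone -> linv f = g.
Proof.
move=> fL f0 gL fg; have [] := linvP fL f0; move: (linv f) => h [M1 hM] fh.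
have [N fN0 fN] := laurent_top fL f0; case: gL => M2 gM.
pose M := Num.max M1 M2.
have {}hM k : M < k -> h k = 0 by rewrite gt_max => /andP [/hM].
have {}gM k : M < k -> g k = 0 by rewrite gt_max => /andP [_ /gM].
have hg n : h (M - Posz n) = g (M - Posz n).
  elim/ltn_ind: n => n IHn.
  have := lmulE n fN hM; rewrite fh -fg (lmulE n fN gM) !big_ord_recl subn0.
  rewrite (eq_bigr (fun i : 'I_n => f (N - (lift ord0 i : nat)%:Z) *
    h (M - (n - lift ord0 i)%N%:Z))) => [|i _]; last first.
    by rewrite IHn //; have := ltn_ord i; rewrite lift0; lia.
  by move=> /addIr; rewrite subr0 => /(mulfI fN0) ->.
apply/funext => k; have [Mk|kM] := ltP M k; first by rewrite hM ?gM.
by rewrite (_ : k = M - Posz `|M - k|%N) ?hg //; lia.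
Qed.

Definition ldiv f g : int -> R := lmul f (linv g).

Definition lexp f (j : int) : int -> R :=
  match j with
  | Posz n => iter n (lmul f) lone
  | Negz n => iter n.+1 (lmul (linv f)) lone
  end.

(* g(h(z)) = \sum_j g_j h(z)^j; when h has positive degree in z, each coefficient
   receives only finitely many nonzero contributions. *)
Definition lcomp g h : int -> R :=
  fun k => \sum_(j \in [set: int]) g j * lexp h j k.

Definition lderiv f : int -> R := fun k => (k + 1)%:~R * f (k + 1).

(* \sum_n m_n z^(- n - 1), as [Negz n] is - n - 1. *)
Definition cauchy_series (m : nat -> R) : int -> R :=
  fun k => if k is Negz n then m n else 0.

Definition G_meas (mu : probability (measurableTypeR R) R) : int -> R :=
  cauchy_series (moment mu).

Definition G_func (mu' : {scalar {poly R}}) : int -> R :=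
  cauchy_series (fun n => mu' 'X^n).

Definition theta (mu : probability (measurableTypeR R) R) : int -> R :=
  ldiv (G_meas mu) (G_meas mu - zinv).

End Laurent.

(* Main.v *)
Require Import Defs.
From HB Require Import structures.
From mathcomp Require Import all_boot all_order all_algebra.
From mathcomp Require Import all_classical all_reals all_analysis.
From mathcomp Require Import all_fingroup complex measurable_realfun zify ring.
Import Order.TTheory GRing.Theory Num.Theory numFieldNormedType.Exports.
Local Open Scope classical_set_scope.
Local Open Scope ring_scope.

Set Implicit Arguments.
Unset Strict Implicit.
Unset Printing Implicit Defensive.

(** Put t = 1/z.  A monic polynomial f of degree d with roots l_1, ..., l_d is
    encoded by its reversed polynomial F(t) = t^d f(1/t) = \prod_i (1 - l_i t), and
    Newton's identities say - t F'(t) = F(t) S(t), where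
    S(t) = \sum_(n >= 1) d m_n(f) t^n.  Hence d times a difference of moments of
    two polynomials is a coefficient of the logarithmic derivative of the quotient
    of their reversed polynomials, and the theorem becomes the computation of the
    coefficientwise limit of one such quotient.

    As nu is the Dirac mass at 1, the roots of q_d concentrate there, and q_d is
    expanded as \sum_j b_j (x - 1)^(d - j).  The b_j are, up to sign, the
    elementary symmetric functions of the numbers l - 1, l a root of q_d, and the
    power sums of these numbers are bounded: the n-th one converges to
    a_n = nu'((x - 1)^n), by the definition of nu' ([newton_shift]).  So each b_j
    has a limit B_j, and - u B'(u) = B(u) \sum_n a_n u^n for B(u) = \sum_j B_j u^j
    ([fps_cvg_log_derivative]).  Finite-free convolution with (-1)^j (x - 1)^(d - j)
    is a differential operator: on reversed polynomials it sends P to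
    t^j P^(j) / (d (d - 1) ... (d - j + 1)) ([rev_fps_ffmul]).  Since - t P' / P is
    d times a series which converges to w(t) = \sum_(n >= 1) m_n(mu) t^n, the
    quotient t^j P^(j) / (d^j P) converges to (- w)^j, and the reversed polynomial
    of the convolution divided by P converges to B(w) ([ratio_cvg]).  Taking
    logarithmic derivatives, d (m_n(p_d * q_d) - m_n(p_d)) converges to the n-th
    coefficient of the series D such that w D = t w' \sum_n a_n w^n
    ([ffmul_moment_difference]).  In particular the moments of the convolution
    have the same limits as those of p_d.

    It remains to recognize D.  From z G_mu(z) = 1 + w one gets theta = 1 + 1/w,
    so that 1/theta = w / (1 + w).  As \sum_n x^n s^(n + 1) = s / (1 - x s), the
    substitution s = u / (1 + u) turns the moments of nu' into the a_n, which gives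
    G_nu'(theta) = \sum_n a_n w^(n + 1); with w^2 theta'(z) = t^2 w'(t) this makes
    G_nu'(theta) theta' equal to t D(t) ([lcomp_theta_lderiv]).  The assumption
    that mu is not the Dirac mass at 0 is what makes w nonzero.

    Finally mu is the free multiplicative convolution of mu and the Dirac mass at
    1, since the free cumulants of the latter are 1, 0, 0, ... and the Kreweras
    complement of a partition consists of singletons only for the partition with
    one block ([kreweras_sum]). *)

(** * Formal power series *)

(** A synonym of [nat -> K], because functions into a ring already carry the
    pointwise product. *)
Definition fps (K : Type) : Type := nat -> K.

Section Ring.
Variable K : comNzRingType.
Implicit Types (f g h : fps K) (n m : nat).

HB.instance Definition _ := GRing.Lmodule.copy (fps K) (nat -> K^o).

Definition fps_mul f g : fps K := fun n => \sum_(i < n.+1) f i * g (n - i)%N.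
Definition fps_one : fps K := fun n => (n == 0)%:R.
(** A coefficient of a product depends on finitely many coefficients of its factors,
    so the ring axioms are inherited from polynomials. *)
Definition fps_trunc N f : {poly K} := \poly_(i < N) f i.

Lemma fps_mul_trunc f g n N : (n < N)%N ->
  fps_mul f g n = (fps_trunc N f * fps_trunc N g)`_n.
Proof.
move=> nN; rewrite coefM; apply: eq_bigr => i _; rewrite !coef_poly.
by rewrite !ifT //; have := ltn_ord i; lia.
Qed.

Lemma fps_mulA : associative fps_mul.
Proof.
move=> f g h; apply/funext => n.
transitivity ((fps_trunc n.+1 f * fps_trunc n.+1 g * fps_trunc n.+1 h)`_n).
  rewrite -mulrA coefM; apply: eq_bigr => i _.
  rewrite coef_poly ltn_ord (@fps_mul_trunc _ _ _ n.+1) //.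
  by rewrite ltnS leq_subr.
rewrite coefM; apply: eq_bigr => i _.
rewrite coef_poly ifT; last by rewrite ltnS leq_subr.
by rewrite -(@fps_mul_trunc _ _ _ n.+1) ?ltn_ord.
Qed.

Lemma fps_mulC : commutative fps_mul.
Proof.
by move=> f g; apply/funext => n; rewrite !(@fps_mul_trunc _ _ n n.+1) // mulrC.
Qed.

Lemma fps_mul1 : left_id fps_one fps_mul.
Proof.
move=> f; apply/funext => n; rewrite /fps_mul big_ord_recl subn0 mul1r.
by rewrite big1 ?addr0 // => i _; rewrite mul0r.
Qed.

Lemma fps_mulDl : left_distributive fps_mul +%R.
Proof.
move=> f g h; apply/funext => n; rewrite /fps_mul.
by under eq_bigr do rewrite mulrDl; rewrite big_split.
Qed.

Lemma fps_one_neq0 : fps_one != 0.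
Proof.
apply/eqP => /(congr1 (fun f => f 0%N)) /eqP.
by rewrite /fps_one eqxx; apply/negP; rewrite oner_eq0.
Qed.

HB.instance Definition _ := GRing.Zmodule_isComNzRing.Build (fps K)
  fps_mulA fps_mulC fps_mul1 fps_mulDl fps_one_neq0.

Lemma fps_coefM f g n : (f * g) n = \sum_(i < n.+1) f i * g (n - i)%N.
Proof. by []. Qed.

Lemma fps_coef1 n : (1 : fps K) n = (n == 0)%:R.
Proof. by []. Qed.

Lemma fps_coefD f g n : (f + g) n = f n + g n.
Proof. by []. Qed.

Lemma fps_coefN f n : (- f) n = - f n.
Proof. by []. Qed.

Lemma fps_coefB f g n : (f - g) n = f n - g n.
Proof. by []. Qed.

Lemma fps_coefZ a f n : (a *: f) n = a * f n.
Proof. by []. Qed.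

Lemma fps_coef_sum I (r : seq I) (P : pred I) (F : I -> fps K) n :
  (\sum_(i <- r | P i) F i) n = \sum_(i <- r | P i) F i n.
Proof. by elim/big_rec2: _ => // i x y _ <-. Qed.

Lemma fps_scaleAl (a : K) f g : a *: (f * g) = (a *: f) * g.
Proof.
apply/funext => n; rewrite fps_coefZ !fps_coefM mulr_sumr.
by apply: eq_bigr => i _; rewrite mulrA.
Qed.

HB.instance Definition _ := GRing.Lmodule_isLalgebra.Build K (fps K) fps_scaleAl.
HB.instance Definition _ := GRing.Lalgebra_isComAlgebra.Build K (fps K).

Lemma fps_coefMn f k n : (f *+ k) n = f n *+ k.
Proof. by elim: k => // k IHk; rewrite !mulrS fps_coefD IHk. Qed.

Lemma fps_coef0M f g : (f * g) 0%N = f 0%N * g 0%N.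
Proof. by rewrite fps_coefM big_ord1. Qed.

Definition fps_X : fps K := fun n => (n == 1)%:R.

Lemma fps_coefXM f n : (fps_X * f) n = if n is k.+1 then f k else 0.
Proof.
rewrite fps_coefM; case: n => [|n]; first by rewrite big_ord1 mul0r.
rewrite big_ord_recl mul0r add0r big_ord_recl mul1r subn1 big1 ?addr0 // => i _.
by rewrite mul0r.
Qed.

Lemma fps_coefXnM f k n : (fps_X ^+ k * f) n = if (n < k)%N then 0 else f (n - k)%N.
Proof.
elim: k n => [|k IHk] n; first by rewrite expr0 mul1r ltn0 subn0.
by rewrite exprS -mulrA fps_coefXM; case: n => // n; rewrite IHk.
Qed.

Lemma fps_X_lreg : GRing.lreg fps_X.
Proof.
move=> f g /funeqP fg; apply/funext => n.
by have := fg n.+1; rewrite !fps_coefXM.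
Qed.

(** The order of f at 0 is at least k. *)
Definition vanishes_below k f := forall i, (i < k)%N -> f i = 0.

Lemma vanishes_belowM k l f g :
  vanishes_below k f -> vanishes_below l g -> vanishes_below (k + l)%N (f * g).
Proof.
move=> fk gl i ikl; rewrite fps_coefM big1 // => j _.
have [jk|kj] := ltnP j k; first by rewrite fk ?mul0r.
by rewrite [g _]gl ?mulr0 //; have := ltn_ord j; lia.
Qed.

Lemma vanishes_belowX f n : f 0%N = 0 -> vanishes_below n (f ^+ n).
Proof.
move=> f0; elim: n => // n IHn; rewrite exprS -add1n; apply: vanishes_belowM => // i.
by rewrite ltnS leqn0 => /eqP ->.
Qed.

Lemma fps_mul_eq_trunc f f' g n : (forall i, (i <= n)%N -> f i = f' i) ->
  (f * g) n = (f' * g) n.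
Proof. by move=> ff'; apply: eq_bigr => i _; rewrite ff' // -ltnS. Qed.

(** The series a(f), for f without constant term: the powers f^n with n > m do not
    contribute to the coefficient of t^m. *)
Definition fps_comp (a f : fps K) : fps K :=
  fun m => (\sum_(n < m.+1) a n *: f ^+ n) m.

(** Up to any given degree, composition is evaluation of a polynomial in the algebra
    of power series; this is what transfers multiplicativity of evaluation to
    composition. *)
Lemma fps_compE (g : {poly K}) a f m : f 0%N = 0 ->
  (forall i, (i <= m)%N -> g`_i = a i) -> fps_comp a f m = horner_alg f g m.
Proof.
move=> f0 ga; rewrite /fps_comp /horner_alg /= /horner_morph.
rewrite (@horner_coef_wide _ (size g + m.+1)%N) ?addnS; last first.
  by apply: leq_trans (size_poly _ _) _; lia.
rewrite !fps_coef_sum -addnS addnC big_split_ord /= [X in _ = _ + X]big1 ?addr0.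
  apply: eq_bigr => i _.
  by rewrite coef_map /= mulr_algl ga // -ltnS.
move=> i _; rewrite coef_map /= mulr_algl fps_coefZ vanishes_belowX ?mulr0 //.
by rewrite ltnS leq_addr.
Qed.

Lemma fps_comp_eq a b f m : (forall i, (i <= m)%N -> a i = b i) ->
  fps_comp a f m = fps_comp b f m.
Proof.
move=> ab; rewrite /fps_comp !fps_coef_sum; apply: eq_bigr => i _.
by rewrite !fps_coefZ ab // -ltnS.
Qed.

Lemma fps_comp_widen a f m N : f 0%N = 0 -> (m < N)%N ->
  fps_comp a f m = (\sum_(n < N) a n *: f ^+ n) m.
Proof.
move=> f0 mN; rewrite /fps_comp (big_ord_widen_cond N xpredT (fun n => a n *: f ^+ n)) //.
rewrite !fps_coef_sum [RHS](bigID (fun n : 'I_N => (n < m.+1)%N)) /=.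
rewrite [X in _ = _ + X]big1 ?addr0 // => n; rewrite -leqNgt => ni.
by rewrite fps_coefZ vanishes_belowX ?mulr0.
Qed.

Lemma fps_comp_trunc a f m N : f 0%N = 0 -> (m < N)%N ->
  fps_comp a f m = horner_alg f (fps_trunc N a) m.
Proof.
by move=> f0 mN; apply: fps_compE => // i im; rewrite coef_poly ifT //; lia.
Qed.

Lemma fps_compM a b f : f 0%N = 0 ->
  fps_comp (a * b) f = fps_comp a f * fps_comp b f.
Proof.
move=> f0; apply/funext => m.
rewrite (@fps_compE (fps_trunc m.+1 a * fps_trunc m.+1 b)) //.
  rewrite rmorphM /= [LHS]fps_coefM; apply: eq_bigr => i _.
  rewrite -!fps_comp_trunc //; first by rewrite ltnS leq_subr.
by move=> i im; rewrite -fps_mul_trunc.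
Qed.

Lemma fps_compD a b f : fps_comp (a + b) f = fps_comp a f + fps_comp b f.
Proof.
apply/funext => m; rewrite /fps_comp fps_coefD !fps_coef_sum -big_split /=.
by apply: eq_bigr => i _; rewrite -fps_coefD scalerDl.
Qed.

Lemma fps_compN a f : fps_comp (- a) f = - fps_comp a f.
Proof.
apply/funext => m; rewrite /fps_comp fps_coefN !fps_coef_sum -sumrN.
by apply: eq_bigr => i _; rewrite -fps_coefN scaleNr.
Qed.

Lemma fps_compZ c a f : fps_comp (c *: a) f = c *: fps_comp a f.
Proof.
apply/funext => m; rewrite /fps_comp fps_coefZ !fps_coef_sum mulr_sumr.
by apply: eq_bigr => i _; rewrite -fps_coefZ scalerA.
Qed.

Lemma fps_comp0 f : fps_comp 0 f = 0.
Proof. by have := fps_compZ 0 0 f; rewrite !scale0r. Qed.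

Lemma fps_comp_X f : f 0%N = 0 -> fps_comp fps_X f = f.
Proof.
move=> f0; apply/funext => m; rewrite (@fps_compE 'X) ?horner_algX //.
by move=> i _; rewrite coefX.
Qed.

Lemma fps_comp1 f : f 0%N = 0 -> fps_comp 1 f = 1.
Proof.
move=> f0; apply/funext => m; rewrite (@fps_compE 1) ?rmorph1 //.
by move=> i _; rewrite coef1.
Qed.

Lemma fps_comp_exp a f n : f 0%N = 0 ->
  fps_comp (a ^+ n) f = fps_comp a f ^+ n.
Proof.
move=> f0; elim: n => [|n IHn]; first by rewrite !expr0 fps_comp1.
by rewrite !exprS fps_compM // IHn.
Qed.

Lemma fps_comp_sum I (r : seq I) (P : pred I) (F : I -> fps K) f :
  fps_comp (\sum_(i <- r | P i) F i) f = \sum_(i <- r | P i) fps_comp (F i) f.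
Proof.
apply: (big_morph (fun a => fps_comp a f)); last exact: fps_comp0.
by move=> a b; rewrite fps_compD.
Qed.

Lemma fps_comp_coef0 a f : fps_comp a f 0%N = a 0%N.
Proof.
by rewrite /fps_comp big_ord1 expr0 fps_coefZ fps_coef1 eqxx mulr1.
Qed.

Lemma fps_compA a f g : f 0%N = 0 -> g 0%N = 0 ->
  fps_comp a (fps_comp f g) = fps_comp (fps_comp a f) g.
Proof.
move=> f0 g0; apply/funext => m.
rewrite (@fps_comp_eq _ (\sum_(n < m.+1) a n *: f ^+ n) g m); last first.
  by move=> i im; rewrite (@fps_comp_widen _ _ _ m.+1).
rewrite fps_comp_sum -[LHS]/((\sum_(n < m.+1) a n *: fps_comp f g ^+ n) m).
by congr (_ m); apply: eq_bigr => i _; rewrite fps_compZ fps_comp_exp.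
Qed.

(** The geometric series in 1 - f; it is the inverse when f has constant term 1. *)
Definition fps_inv f : fps K := fps_comp (fun=> 1) (1 - f).

Lemma fps_mulV f : f 0%N = 1 -> f * fps_inv f = 1.
Proof.
move=> f0; have g0 : (1 - f) 0%N = 0 by rewrite fps_coefB f0 subrr.
have fE : f = fps_comp (1 - fps_X) (1 - f).
  by rewrite fps_compD fps_compN fps_comp_X // fps_comp1 // subKr.
rewrite {1}fE -fps_compM // -[RHS](fps_comp1 g0); congr fps_comp.
apply/funext => n; rewrite mulrBl mul1r fps_coefB fps_coefXM.
by case: n => [|n]; rewrite ?subr0 ?subrr.
Qed.

Lemma fps_mulI f : f 0%N = 1 -> GRing.lreg f.
Proof.
move=> f0 g h fgh; rewrite -[g]mul1r -[h]mul1r -(fps_mulV f0).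
by rewrite ![f * _]mulrC -!mulrA fgh.
Qed.

(** The derivation t d/dt.  Unlike d/dt it does not shift the coefficients, so that
    Newton's identities and the recursions below need no index arithmetic. *)
Definition euler f : fps K := fun n => f n *+ n.

Lemma eulerD f g : euler (f + g) = euler f + euler g.
Proof. by apply/funext => n; rewrite /euler fps_coefD mulrnDl. Qed.

Lemma eulerN f : euler (- f) = - euler f.
Proof. by apply/funext => n; rewrite /euler fps_coefN mulNrn. Qed.

Lemma eulerZ a f : euler (a *: f) = a *: euler f.
Proof. by apply/funext => n; rewrite /euler fps_coefZ -mulrnAr. Qed.

Lemma eulerM f g : euler (f * g) = euler f * g + f * euler g.
Proof.
apply/funext => n; rewrite /euler fps_coefD !fps_coefM -big_split -sumrMnl /=.
apply: eq_bigr => i _; rewrite mulrnAl mulrnAr -mulrnDr subnKC //.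
by rewrite -ltnS.
Qed.

Lemma euler1 : euler 1 = 0.
Proof. by apply/funext => -[|n]; rewrite /euler ?mulr0n ?mul0rn. Qed.

Lemma euler_sum I (r : seq I) (P : pred I) (F : I -> fps K) :
  euler (\sum_(i <- r | P i) F i) = \sum_(i <- r | P i) euler (F i).
Proof.
apply: (big_morph euler); first exact: eulerD.
by have := eulerZ 0 0; rewrite !scale0r.
Qed.

Lemma euler_exp f n : f * euler (f ^+ n) = (euler f * f ^+ n) *+ n.
Proof.
elim: n => [|n IHn]; first by rewrite expr0 euler1 mulr0 mulr0n.
by rewrite exprS eulerM mulrDr IHn mulrnAr [in RHS]mulrCA mulrS.
Qed.

(** The chain rule, multiplied by f: composing u a'(u) with f gives f a'(f). *)
Lemma euler_comp a f : f 0%N = 0 ->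
  f * euler (fps_comp a f) = euler f * fps_comp (euler a) f.
Proof.
move=> f0; apply/funext => m.
pose S (b : fps K) := \sum_(n < m.+1) b n *: f ^+ n.
have SE b i : (i <= m)%N -> fps_comp b f i = S b i.
  by move=> im; exact: fps_comp_widen.
transitivity ((f * euler (S a)) m).
  rewrite ![f * _]mulrC; apply: fps_mul_eq_trunc => i im.
  by rewrite /euler SE.
transitivity ((euler f * S (euler a)) m); last first.
  by rewrite ![euler f * _]mulrC; apply: fps_mul_eq_trunc => i im; rewrite SE.
congr (_ m); rewrite /S euler_sum !mulr_sumr; apply: eq_bigr => n _.
by rewrite eulerZ -!scalerAr euler_exp /euler -scalerMnr scalerMnl.
Qed.

End Ring.

(** * The substitution t / (1 + t) *)

Section Binomial.
Variable K : comNzRingType.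
Implicit Types (f g h : fps K) (n m : nat).

(** The series t / (1 + t), that is 1 / theta as a function of w when theta = 1 + 1/w. *)
Definition fps_geom : fps K := fps_X K * fps_inv (1 + fps_X K).

(** If u lists the moments of a linear functional on polynomials, these are the values
    of the functional at the powers of x - 1. *)
Definition inv_binomial (u : nat -> K) : fps K :=
  fun n => \sum_(k < n.+1) (-1) ^+ (n - k) * 'C(n, k)%:R * u k.

Lemma coef01X : (1 + fps_X K) 0%N = 1.
Proof. by rewrite fps_coefD addr0. Qed.

(** The binomial series of (t / (1 + t))^(k+1); the Pascal rule is the relation
    (1 + t) (t / (1 + t))^(k+2) = t (t / (1 + t))^(k+1). *)
Lemma fps_geom_exp k n : (fps_geom ^+ k.+1) n =
  if n is n'.+1 then (-1) ^+ (n' + k) * 'C(n', k)%:R else 0.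
Proof.
pose c k : fps K := fun n => if n is n'.+1 then (-1) ^+ (n' + k) * 'C(n', k)%:R else 0.
have geomE : (1 + fps_X K) * fps_geom = fps_X K.
  by rewrite /fps_geom mulrCA fps_mulV ?coef01X // mulr1.
suff -> : fps_geom ^+ k.+1 = c k by [].
elim: k => [|k IHk]; apply: (fps_mulI coef01X).
  rewrite expr1 geomE; apply/funext => -[|[|m]];
    rewrite mulrDl mul1r fps_coefD fps_coefXM /= ?addr0 // !bin0 ?mulr1 //.
  by rewrite !addn0 exprS mulN1r addNr.
rewrite exprS mulrA geomE IHk; apply/funext => -[|[|m]];
  rewrite mulrDl mul1r fps_coefD !fps_coefXM /= ?addr0 ?mulr0 //.
rewrite binS natrD addSn addnS !exprS; ring.
Qed.

(** Expansion of the resolvent at 1 instead of 0: for s = t / (1 + t) one has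
    s / (1 - x s) = t / (1 - (x - 1) t). *)
Lemma fps_comp_geom (u : nat -> K) :
  fps_comp (fps_X K * (u : fps K)) fps_geom = fps_X K * inv_binomial u.
Proof.
apply/funext => -[|n]; first by rewrite fps_comp_coef0 !fps_coefXM.
rewrite fps_coefXM /inv_binomial /fps_comp fps_coef_sum big_ord_recl.
rewrite [X in X + _](_ : _ = 0) ?add0r; last first.
  by rewrite fps_coefZ fps_coefXM mul0r.
apply: eq_bigr => k _; rewrite fps_coefZ fps_coefXM lift0 fps_geom_exp mulrC.
congr (_ * _ * _); have -> : (n + k = (n - k) + 2 * k)%N by have := ltn_ord k; lia.
by rewrite exprD exprM sqrrN expr1n expr1n mulr1.
Qed.

End Binomial.

Section ThetaAlg.
Variable R : idomainType.
Variables (w : fps R).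
Hypothesis w0 : w 0%N = 0.

Lemma fps_coef01D : (1 + w) 0%N = 1.
Proof. by rewrite fps_coefD w0 addr0. Qed.

Lemma geom_compE : (1 + w) * fps_comp (fps_geom R) w = w.
Proof.
rewrite /fps_geom fps_compM // fps_comp_X // mulrCA.
have {1}-> : 1 + w = fps_comp (1 + fps_X R) w.
  by rewrite fps_compD fps_comp1 // fps_comp_X.
by rewrite -fps_compM // fps_mulV ?fps_comp1 ?mulr1 // coef01X.
Qed.

End ThetaAlg.

(** * Newton's identities *)

Section Newton.
Variable K : comNzRingType.
Implicit Types (p : {poly K}) (d n : nat).

(** The polynomial t^d p(1/t), for p of degree at most d. *)
Definition rev_fps d p : fps K := fun k => if (k <= d)%N then p`_(d - k) else 0.

Lemma rev_fps_mulXsubC z d p : (size p <= d.+1)%N ->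
  rev_fps d.+1 (('X - z%:P) * p) = (1 - z *: fps_X K) * rev_fps d p.
Proof.
move=> sp; apply/funext => k.
rewrite [(1 - _) * _]mulrBl mul1r -scalerAl fps_coefB fps_coefZ fps_coefXM /rev_fps.
rewrite mulrBl coefB coefXM coefCM; case: k => [|k].
  by rewrite !subn0 /= [p`_d.+1]nth_default // !mulr0.
rewrite ltnS subSS subn_eq0; have [kd|dk|<-] := ltngtP k d.
- by rewrite -subnS.
- by rewrite mulr0 subr0.
- by rewrite subnn.
Qed.

Definition power_sums (r : seq K) : fps K :=
  fun n => if n is 0 then 0 else \sum_(z <- r) z ^+ n.

(** Adding a root z multiplies P by 1 - z t, and the logarithmic derivative of this
    factor contributes - \sum_(n >= 1) z^n t^n. *)
Lemma newton_identities (r : seq K) :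
  let P := rev_fps (size r) (\prod_(z <- r) ('X - z%:P)) in
  - euler P = P * power_sums r.
Proof.
elim: r => [|z r IHr] /=.
  have -> : power_sums [::] = 0 by apply/funext => -[|n] //=; rewrite big_nil.
  rewrite mulr0 big_nil; apply/funext => k.
  by rewrite fps_coefN /euler /rev_fps; case: k => [|k]; rewrite ?mulr0n ?mul0rn oppr0.
rewrite big_cons rev_fps_mulXsubC; last by rewrite size_prod_XsubC.
move: IHr => /=; set P := rev_fps _ _ => IHr.
pose Z : fps K := fun n => if n is 0 then 0 else z ^+ n.
have -> : power_sums (z :: r) = Z + power_sums r.
  by apply/funext => -[|n]; rewrite fps_coefD /= ?addr0 ?big_cons.
have ZE : (1 - z *: fps_X K) * Z = z *: fps_X K.
  apply/funext => k; rewrite mulrBl mul1r -scalerAl fps_coefB fps_coefZ fps_coefXM.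
  rewrite fps_coefZ; case: k => [|[|k]]; rewrite /= ?mulr0 ?subr0 ?expr1 ?mulr1 //.
  by rewrite exprS subrr.
have EX : euler (fps_X K) = fps_X K.
  by apply/funext => -[|[|k]]; rewrite /euler // mul0rn.
rewrite eulerM eulerD euler1 add0r eulerN eulerZ EX mulrDr [_ * P * Z]mulrAC ZE.
by rewrite -mulrA -IHr mulNr opprD opprK mulrN.
Qed.

Lemma rev_fps0 d p : p \is monic -> size p = d.+1 -> rev_fps d p 0%N = 1.
Proof.
by move=> /monicP pm sp; rewrite /rev_fps /= subn0 -pm lead_coefE sp.
Qed.

End Newton.

Section RealNewton.
Variable R : realType.
Implicit Types (f q : {poly R}) (d n : nat).

(** The complex identities descend to the real numbers as soon as the power sums of
    the complex roots are real. *)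
Lemma newton_identities_real f (r : seq R[i]) (s : fps R) :
  to_complex f = \prod_(z <- r) ('X - z%:P) ->
  (forall n, real_complex R (s n) = power_sums r n) ->
  - euler (rev_fps (size r) f) = rev_fps (size r) f * s.
Proof.
move=> fE sE.
have revE k : real_complex R (rev_fps (size r) f k) =
    rev_fps (size r) (to_complex f) k.
  by rewrite /rev_fps; case: ifP; rewrite ?rmorph0 // coef_map.
apply/funext => n; apply: (fmorph_inj (real_complex R)).
have /= /(congr1 (fun g => g n)) := newton_identities r.
rewrite -fE !fps_coefN !fps_coefM /euler rmorphN rmorphMn rmorph_sum /= revE => ->.
by apply: eq_bigr => i _; rewrite rmorphM /= revE sE.
Qed.

Lemma size_complex_roots d f : monic_of_degree d f -> size (complex_roots f) = d.
Proof.
case=> fm sf; apply: succn_inj; rewrite -sf -(size_prod_XsubC _ id) /=.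
by rewrite -complex_rootsE // size_map_poly.
Qed.

Definition poly_power_sums d f : fps R :=
  fun n => if n is 0 then 0 else d%:R * poly_moment f n.

Lemma real_complex_moment d f n : (0 < d)%N -> monic_of_degree d f ->
  real_complex R (d%:R * poly_moment f n) = \sum_(z <- complex_roots f) z ^+ n.
Proof.
move=> d0 [fm sf]; rewrite rmorphM /= poly_momentE // sf rmorph_nat mulrC divfK //.
by rewrite pnatr_eq0 -lt0n.
Qed.

Lemma newton_moments d f : (0 < d)%N -> monic_of_degree d f ->
  - euler (rev_fps d f) = rev_fps d f * poly_power_sums d f.
Proof.
move=> d0 fd; rewrite -{1 2}(size_complex_roots fd).
apply: newton_identities_real; first by case: fd => fm _; exact: complex_rootsE.
by case=> [|n]; rewrite ?rmorph0 // [LHS](real_complex_moment _ d0 fd).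
Qed.

Lemma poly_moment0 d f : (0 < d)%N -> monic_of_degree d f -> poly_moment f 0 = 1.
Proof.
move=> d0 fd; have dn0 : d%:R != 0 :> R by rewrite pnatr_eq0 -lt0n.
apply: (mulfI dn0); apply: (fmorph_inj (real_complex R)).
apply: (etrans (real_complex_moment 0 d0 fd)).
rewrite mulr1 rmorph_nat -(size_complex_roots fd).
under eq_bigr do rewrite expr0.
by rewrite big_const_seq count_predT iter_addr_0.
Qed.

(** The roots of q(x + 1) are those of q shifted by - 1.  Replacing the moments of q
    by their differences with 1 changes no power sum of positive exponent, because
    the alternating sum of a row of binomial coefficients is 0; it makes the
    right-hand side converge. *)
Lemma newton_shift d q : (0 < d)%N -> monic_of_degree d q ->
  let B := rev_fps d (q \Po ('X + 1)) in
  - euler B = B * inv_binomial (fun k => d%:R * (poly_moment q k - 1)).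
Proof.
move=> d0 qd /=; set r := [seq z - 1 | z <- complex_roots q].
have -> : d = size r by rewrite size_map (size_complex_roots qd).
apply: newton_identities_real.
  rewrite /to_complex map_comp_poly rmorphD /= map_polyX rmorph1.
  case: (qd) => qm _; rewrite -/(to_complex q) (complex_rootsE qm).
  rewrite rmorph_prod /= big_map; apply: eq_bigr => z _.
  by rewrite rmorphB /= comp_polyX comp_polyC polyCB opprB addrA.
rewrite size_map (size_complex_roots qd) => -[|n].
  by rewrite /inv_binomial big_ord1 (poly_moment0 d0 qd) subrr !mulr0 rmorph0.
rewrite /power_sums big_map rmorph_sum /=.
under [RHS]eq_bigr do rewrite exprBn.
rewrite exchange_big /= [RHS](reindex_inj rev_ord_inj) /=.
under eq_bigr => k _ do rewrite mulrBr mulr1 mulrBr rmorphB.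
rewrite sumrB [X in _ - X](_ : _ = 0).
  rewrite subr0; apply: eq_bigr => k _.
  rewrite rmorphM rmorphM rmorphXn rmorphN1 rmorph_nat.
  rewrite [X in _ * X](real_complex_moment _ d0 qd).
  rewrite mulr_sumr; apply: eq_bigr => z _.
  have kn : (k <= n.+1)%N by rewrite -ltnS.
  by rewrite subSS subKn // bin_sub // expr1n mulr1 mulrAC mulr_natr.
rewrite -rmorph_sum -mulr_suml; apply/eqP; rewrite fmorph_eq0 mulf_eq0; apply/orP; left.
have : (1 - 1 : R) ^+ n.+1 = 0 by rewrite subrr expr0n.
rewrite exprBn (reindex_inj rev_ord_inj) /= => {2}<-; apply/eqP.
apply: eq_bigr => k _; have kn : (k <= n.+1)%N by rewrite -ltnS.
by rewrite !expr1n !mulr1 subSS bin_sub // mulr_natr.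
Qed.

End RealNewton.

(** * Finite-free convolution on reversed polynomials *)

Section FiniteFreeMul.
Variable R : realType.
Implicit Types (p q : {poly R}) (d k j : nat).

Lemma bin_ffact_sub d k j : (j <= k)%N -> (k <= d)%N ->
  ('C(d - j, k - j) * d ^_ j = k ^_ j * 'C(d, k))%N.
Proof.
move=> jk kd; elim: j jk => [|j IHj] jk; first by rewrite !subn0 !ffactn0 muln1 mul1n.
rewrite !ffactnSr [RHS]mulnAC -IHj 1?ltnW // !subnS.
have := mul_bin_diag (d - j) (k - j).-1; rewrite prednK ?subn_gt0 // => E.
transitivity ((d - j) * 'C((d - j).-1, (k - j).-1) * d ^_ j)%N; first by ring.
by rewrite E; ring.
Qed.

Lemma coef_shift d k q : (size q <= d.+1)%N -> (k <= d)%N ->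
  q`_(d - k) = \sum_(j < d.+1)
    rev_fps d (q \Po ('X + 1)) j * ((-1) ^+ (k - j) * 'C(d - j, d - k)%:R).
Proof.
move=> sq kd; set f := q \Po ('X + 1).
have sf : (size f <= d.+1)%N.
  by rewrite /f -polyC1 size_comp_poly2 // size_XaddC.
have -> : q = f \Po ('X - 1).
  rewrite /f -comp_polyA comp_polyD comp_polyX -polyC1 comp_polyC.
  by rewrite subrK comp_polyXr.
rewrite comp_polyE (big_ord_widen _ (fun i => f`_i *: ('X - 1) ^+ i) sf).
rewrite big_mkcond coef_sum (reindex_inj rev_ord_inj) /=.
apply: eq_bigr => j _; have jd : (j <= d)%N by rewrite -ltnS.
rewrite subSS /rev_fps jd.
case: ifPn => [_|]; last by rewrite -leqNgt => ?; rewrite coef0 nth_default ?mul0r.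
rewrite coefZ; congr (_ * _).
have -> : 'X - 1 = 'X + (-1)%:P :> {poly R} by rewrite polyCN.
rewrite exprDn coef_sum; have [jk|kj] := leqP j k; last first.
  rewrite bin_small ?mulr0; last by lia.
  rewrite big1 // => i _; rewrite -polyC_exp coefMn coefMC coefXn.
  by rewrite (_ : _ == _ = false) ?mul0r ?mul0rn //; have := ltn_ord i; lia.
have kj : (k - j < (d - j).+1)%N by lia.
rewrite (bigD1 (Ordinal kj)) //= big1 ?addr0 => [|i ik].
  rewrite -polyC_exp coefMn coefMC coefXn (_ : _ == _ = true); last by lia.
  rewrite mul1r mulr_natr; congr (_ *+ _).
  by rewrite -bin_sub; [congr 'C(_, _); lia | lia].
rewrite -polyC_exp coefMn coefMC coefXn (_ : _ == _ = false) ?mul0r ?mul0rn //.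
apply/negbTE; apply: contra_neq ik => E; apply/val_inj => /=.
by have := ltn_ord i; lia.
Qed.

(** The operator t^j (d/dt)^j. *)
Definition ffact_fps j (f : fps R) : fps R := fun k => (k ^_ j)%:R * f k.

Lemma coef_ffmul d p q k : (k <= d)%N ->
  (ffmul d p q)`_(d - k) = (-1) ^+ k * 'C(d, k)%:R * norm_coef d p k * norm_coef d q k.
Proof.
move=> kd; have kd1 : (k < d.+1)%N by [].
rewrite /ffmul coef_sum (bigD1 (Ordinal kd1)) //= big1 ?addr0 => [|i ik].
  by rewrite coefZ coefXn eqxx mulr1.
rewrite coefZ coefXn (_ : _ == _ = false) ?mulr0 //.
apply/negbTE; apply: contra_neq ik => E; apply/val_inj => /=.
by have := ltn_ord i; lia.
Qed.

(** Only the expansion of q in powers of x - 1 matters: the k-th normalized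
    coefficient of (-1)^j (x - 1)^(d - j) is k^_j / d^_j by [bin_ffact_sub], so that
    convolution with it acts on the reversed polynomial of p as t^j (d/dt)^j / d^_j. *)
Lemma rev_fps_ffmul d p q : (size q <= d.+1)%N ->
  rev_fps d (ffmul d p q) = \sum_(j < d.+1)
    ((-1) ^+ j * rev_fps d (q \Po ('X + 1)) j / (d ^_ j)%:R) *:
      ffact_fps j (rev_fps d p).
Proof.
move=> sq; apply/funext => k; rewrite fps_coef_sum {1}/rev_fps.
case: ifPn => [kd|kd]; last first.
  rewrite big1 // => j _; rewrite fps_coefZ /ffact_fps [rev_fps d p k]/rev_fps.
  by rewrite (negbTE kd) !mulr0.
have Cn0 : 'C(d, k)%:R != 0 :> R by rewrite pnatr_eq0 -lt0n bin_gt0.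
rewrite coef_ffmul // /norm_coef.
transitivity (p`_(d - k) * (((-1) ^+ k / 'C(d, k)%:R) * q`_(d - k))).
  transitivity (((-1) ^+ k * (-1) ^+ k) * p`_(d - k) *
    (((-1) ^+ k / 'C(d, k)%:R) * q`_(d - k))).
    by field.
  by rewrite -signr_odd -expr2 sqrr_sign mul1r.
rewrite (coef_shift sq kd) !mulr_sumr; apply: eq_bigr => j _.
rewrite fps_coefZ /ffact_fps [rev_fps d p k]/rev_fps kd.
have jd : (j <= d)%N by rewrite -ltnS.
have [jk|kj] := leqP j k; last first.
  rewrite (bin_small (_ : d - j < d - k)%N); last by lia.
  by rewrite (ffact_small kj) mul0r !mulr0.
have dn0 : (d ^_ j)%:R != 0 :> R by rewrite pnatr_eq0 -lt0n ffact_gt0.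
have -> : 'C(d - j, d - k)%:R = (k ^_ j)%:R * 'C(d, k)%:R / (d ^_ j)%:R :> R.
  apply: (mulIf dn0); rewrite divfK // -!natrM -(bin_ffact_sub jk kd).
  by rewrite -(@bin_sub (d - j) (k - j)) ?leq_sub2r // (_ : (d - j - _ = d - k)%N) //; lia.
have -> : (-1) ^+ k = (-1) ^+ j * (-1) ^+ (k - j) :> R by rewrite -exprD subnKC.
have s1 : (-1) ^+ (k - j) * (-1) ^+ (k - j) = 1 :> R by rewrite -expr2 sqrr_sign.
transitivity (((-1) ^+ (k - j) * (-1) ^+ (k - j)) *
  ((-1) ^+ j * rev_fps d (q \Po ('X + 1)) j / (d ^_ j)%:R * ((k ^_ j)%:R * p`_(d - k)))).
  by field; rewrite dn0 Cn0.
by rewrite s1 mul1r.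
Qed.

Lemma ffmul_monic d p q : monic_of_degree d p -> monic_of_degree d q ->
  monic_of_degree d (ffmul d p q).
Proof.
move=> [/monicP pm sp] [/monicP qm sq].
have lc : (ffmul d p q)`_d = 1.
  have := @coef_ffmul d p q 0 (leq0n d); rewrite subn0 => ->.
  rewrite /norm_coef bin0 subn0 expr0 !mul1r !divr1.
  by move: pm qm; rewrite !lead_coefE sp sq => -> ->; rewrite mulr1.
have sz : size (ffmul d p q) = d.+1.
  apply/eqP; rewrite eqn_leq; apply/andP; split.
    rewrite /ffmul; apply: (leq_trans (size_sum _ _ _)); apply/bigmax_leqP => i _.
    apply: leq_trans (size_scale_leq _ _) _; rewrite size_polyXn.
    by rewrite ltnS leq_subr.
  rewrite ltnNge; apply/negP => /(nth_default 0) E; move: lc.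
  by rewrite E => /eqP; rewrite eq_sym oner_eq0.
by split=> //; apply/monicP; rewrite lead_coefE sz.
Qed.

End FiniteFreeMul.

(** * Coefficientwise convergence of power series *)

Section Convergence.
Variable R : realType.
Implicit Types (f g : nat -> fps R) (F G : fps R) (c : nat -> R).

Definition fps_cvg f F := forall k, f d k @[d --> \oo] --> F k.

Lemma cvg_inv_nat : (d%:R : R)^-1 @[d --> \oo] --> (0 : R).
Proof. by rewrite -cvg_shiftS; exact: cvg_harmonic. Qed.

Lemma cvg_sum_ord n (u : nat -> 'I_n -> R) (l : 'I_n -> R) :
  (forall i, u d i @[d --> \oo] --> l i) ->
  \sum_(i < n) u d i @[d --> \oo] --> \sum_(i < n) l i.
Proof. by move=> ul; apply: cvg_big => //; exact: add_continuous. Qed.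

Lemma fps_cvg_near f g F : (\forall d \near \oo, f d = g d) ->
  fps_cvg g F -> fps_cvg f F.
Proof.
move=> fg gF k; apply: cvg_trans (gF k); apply: near_eq_cvg.
by apply: filterS fg => d ->.
Qed.

Lemma fps_cvg_cst F : fps_cvg (fun=> F) F.
Proof. by move=> k; exact: cvg_cst. Qed.

Lemma fps_cvgD f g F G : fps_cvg f F -> fps_cvg g G ->
  fps_cvg (fun d => f d + g d) (F + G).
Proof. by move=> fF gG k; exact: cvgD. Qed.

Lemma fps_cvgN f F : fps_cvg f F -> fps_cvg (fun d => - f d) (- F).
Proof. by move=> fF k; exact: cvgN. Qed.

Lemma fps_cvgZ c (l : R) f F : c d @[d --> \oo] --> l -> fps_cvg f F ->
  fps_cvg (fun d => c d *: f d) (l *: F).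
Proof. by move=> cl fF k; exact: cvgM. Qed.

Lemma fps_cvgM f g F G : fps_cvg f F -> fps_cvg g G ->
  fps_cvg (fun d => f d * g d) (F * G).
Proof. by move=> fF gG k; apply: cvg_sum_ord => i; exact: cvgM. Qed.

Lemma fps_cvgX f F n : fps_cvg f F -> fps_cvg (fun d => f d ^+ n) (F ^+ n).
Proof.
move=> fF; elim: n => [|n IHn]; first exact: fps_cvg_cst.
have -> : (fun d => f d ^+ n.+1) = (fun d => f d * f d ^+ n).
  by apply/funext => d; rewrite exprS.
by rewrite exprS; exact: fps_cvgM.
Qed.

Lemma fps_cvg_euler f F : fps_cvg f F -> fps_cvg (fun d => euler (f d)) (euler F).
Proof. by move=> fF k; apply: cvgMn; exact: fF. Qed.

Lemma fps_cvg_inv f F : fps_cvg f F -> fps_cvg (fun d => fps_inv (f d)) (fps_inv F).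
Proof.
move=> fF k; rewrite /fps_inv /fps_comp fps_coef_sum.
have -> : (fun d => (\sum_(n < k.+1) 1 *: (1 - f d) ^+ n) k) =
          (fun d => \sum_(n < k.+1) ((1 - f d) ^+ n) k).
  by apply/funext => d; rewrite fps_coef_sum; apply: eq_bigr => n _; rewrite scale1r.
apply: cvg_sum_ord => n; rewrite scale1r; apply: fps_cvgX => j.
by apply: cvgB; [exact: cvg_cst | exact: fF].
Qed.

(** The equation - t f' = f a determines the coefficients of f recursively as polynomials
    in those of a, so f converges when a does. *)
Lemma fps_cvg_log_derivative f (a : nat -> fps R) (A : fps R) :
  (\forall d \near \oo, - euler (f d) = f d * a d) ->
  (\forall d \near \oo, f d 0%N = 1) -> (forall d, a d 0%N = 0) ->
  fps_cvg a A ->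
  exists F : fps R, [/\ fps_cvg f F, F 0%N = 1 & - euler F = F * A].
Proof.
move=> fa f1 a0 aA.
have f0 : f d 0%N @[d --> \oo] --> (1 : R) by exact: cvg_near_cst.
have fk k : cvgn (fun d => f d k).
  elim/ltn_ind: k => -[|k] IHk; first by apply/cvg_ex; exists 1.
  apply/cvg_ex; exists (- (k.+1%:R)^-1 *
    \sum_(i < k.+1) limn (fun d => f d i) * A (k.+1 - i)%N).
  apply: (@cvg_trans _ ((- (k.+1%:R)^-1 *
    \sum_(i < k.+1) f d i * a d (k.+1 - i)%N) @[d --> \oo])).
    apply: near_eq_cvg; apply: filterS fa => d /(congr1 (fun h => h k.+1)).
    rewrite fps_coefN fps_coefM big_ord_recr /= subnn a0 mulr0 addr0 => <-.
    by rewrite /euler mulrNN -[f d k.+1 *+ _]mulr_natl mulKf // pnatr_eq0.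
  apply: cvgM; first exact: cvg_cst.
  by apply: cvg_sum_ord => i; apply: cvgM; [exact: IHk | exact: aA].
pose F : fps R := fun k => limn (fun d => f d k).
have fF : fps_cvg f F by move=> k; exact: fk.
exists F; split=> //; first exact: (cvg_lim _ f0).
apply/funext => k.
have EF := fps_cvgN (fps_cvg_euler fF).
apply: (cvg_unique _ (EF k)) => //.
exact: (fps_cvg_near fa (fps_cvgM fF aA)).
Qed.

End Convergence.

(** * The limit of the moment differences *)

Section MulLimit.
Variable R : realType.
Implicit Types (P S w : fps R) (d j k : nat).

Lemma ffact_fpsS j P : ffact_fps j.+1 P = euler (ffact_fps j P) - ffact_fps j P *+ j.
Proof.
apply/funext => k; rewrite fps_coefB fps_coefMn /euler /ffact_fps ffactnSr.
have [jk|kj] := leqP j k; last by rewrite (ffact_small kj) !mul0r !mul0rn subrr.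
by rewrite -mulrnBr // natrM mulrAC mulr_natr.
Qed.

Lemma ffact_fps_vanishes j P : vanishes_below j (ffact_fps j P).
Proof. by move=> k kj; rewrite /ffact_fps ffact_small ?mul0r. Qed.

(** The series t^j P^(j) / (d^j P). *)
Definition normalized_derivative P j d : fps R :=
  fps_inv P * ((d%:R^-1) ^+ j *: ffact_fps j P).

Lemma normalized_derivative0 P d : P 0%N = 1 -> normalized_derivative P 0 d = 1.
Proof.
move=> P0; rewrite /normalized_derivative expr0 scale1r.
have -> : ffact_fps 0 P = P by apply/funext => k; rewrite /ffact_fps ffactn0 mul1r.
by rewrite mulrC fps_mulV.
Qed.

Lemma normalized_derivative_vanishes P j d : vanishes_below j (normalized_derivative P j d).
Proof.
rewrite -[j]add0n; apply: vanishes_belowM => // k kj.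
by rewrite fps_coefZ ffact_fps_vanishes ?mulr0.
Qed.

(** The product rule for t^j P^(j) = P d^j X.  The term where P is differentiated is of
    order d, and the others are of order 1, which is why only the powers of S / d
    survive in the limit. *)
Lemma normalized_derivativeS P S j d : P 0%N = 1 -> - euler P = P * S ->
  let X := normalized_derivative P j d in
  normalized_derivative P j.+1 d =
  - (d%:R^-1 *: S) * X + d%:R^-1 *: (euler X - X *+ j).
Proof.
move=> P0 PS X; set c := d%:R^-1.
have PX i : P * normalized_derivative P i d = c ^+ i *: ffact_fps i P.
  by rewrite /normalized_derivative mulrA fps_mulV // mul1r.
have EP : euler P = - (P * S) by rewrite -PS opprK.
have := congr1 (@euler R) (PX j); rewrite eulerM eulerZ EP -/X => E.
apply: (fps_mulI P0); rewrite PX ffact_fpsS scalerBr exprS -scalerA -E.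
rewrite -scalerA -[c ^+ j *: (_ *+ j)]scalerMnr -PX -/X.
rewrite -scalerBr -scalerN -scalerAl -scalerDr -scalerAr; congr (_ *: _).
by ring.
Qed.

Lemma cvg_expn_ffact j : (d%:R : R) ^+ j / (d ^_ j)%:R @[d --> \oo] --> (1 : R).
Proof.
suff H : (d ^_ j)%:R / (d%:R : R) ^+ j @[d --> \oo] --> (1 : R).
  have -> : (fun d : nat => (d%:R : R) ^+ j / (d ^_ j)%:R) =
      (fun d : nat => ((d ^_ j)%:R / (d%:R : R) ^+ j)^-1).
    by apply/funext => d; rewrite invf_div.
  have H1 : (1 : R)^-1 = 1 by exact: invr1.
by rewrite -[X in _ `=>` nbhs X]H1; exact: (cvgV (oner_neq0 R) H).
elim: j => [|j IHj].
  by apply: cvg_near_cst; near=> d; rewrite ffactn0 expr0 divr1.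
have H : 1 - j%:R * (d%:R : R)^-1 @[d --> \oo] --> (1 - j%:R * 0 : R).
  apply: cvgB; first exact: cvg_cst.
  by apply: cvgM; [exact: cvg_cst | exact: cvg_inv_nat].
have : (d ^_ j)%:R / (d%:R : R) ^+ j * (1 - j%:R * (d%:R : R)^-1) @[d --> \oo] -->
    (1 * (1 - j%:R * 0) : R) by exact: cvgM.
rewrite mulr0 subr0 mulr1; apply: cvg_trans; apply: near_eq_cvg.
near=> d; have dj : (j < d)%N by near: d; exact: nbhs_infty_gt.
rewrite ffactnSr natrM natrB 1?ltnW // exprSr.
have d0 : d%:R != 0 :> R by rewrite pnatr_eq0; lia.
by rewrite /=; field; rewrite d0 expf_neq0.
Unshelve. all: by end_near. Qed.

(** As the j-th series has order at least j, a coefficient of the growing sum is a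
    sum of a fixed number of terms once d is large. *)
Lemma cvg_sum_low (c : nat -> nat -> R) (C : nat -> R) (x : nat -> nat -> fps R)
    (y : nat -> fps R) :
  (forall j, c j d @[d --> \oo] --> C j) -> (forall j, fps_cvg (x j) (y j)) ->
  (forall j d, vanishes_below j (x j d)) ->
  fps_cvg (fun d => \sum_(j < d.+1) c j d *: x j d)
          (fun k => (\sum_(j < k.+1) C j *: y j) k).
Proof.
move=> cC xy xlow k; rewrite fps_coef_sum.
apply: (@cvg_trans _ ((\sum_(j < k.+1) c j d * x j d k) @[d --> \oo])).
  apply: near_eq_cvg; near=> d; have kd : (k <= d)%N by near: d; exact: nbhs_infty_ge.
  rewrite fps_coef_sum.
  rewrite (big_ord_widen_cond d.+1 xpredT (fun j => c j d * x j d k)) //.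
  rewrite [RHS](bigID (fun j : 'I_d.+1 => (j < k.+1)%N)) /=.
  rewrite [X in _ = _ + X]big1 ?addr0 // => j; rewrite -leqNgt => kj.
  by rewrite fps_coefZ xlow ?mulr0.
by apply: cvg_sum_ord => j; apply: cvgM; [exact: cC | exact: xy].
Unshelve. all: by end_near. Qed.

Section Limit.
Variables (P S : nat -> fps R) (w : fps R).
Hypothesis P0 : \forall d \near \oo, P d 0%N = 1.
Hypothesis PS : \forall d \near \oo, - euler (P d) = P d * S d.
Hypothesis Sw : fps_cvg (fun d => d%:R^-1 *: S d) w.

Lemma normalized_derivative_cvg j :
  fps_cvg (fun d => normalized_derivative (P d) j d) ((- w) ^+ j).
Proof.
elim: j => [|j IHj].
  rewrite expr0; apply: (@fps_cvg_near _ _ (fun=> 1)); last exact: fps_cvg_cst.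
  by apply: filterS P0 => d; exact: normalized_derivative0.
have EX : fps_cvg (fun d => d%:R^-1 *: (euler (normalized_derivative (P d) j d)
    - normalized_derivative (P d) j d *+ j)) 0.
  rewrite -(scale0r (euler ((- w) ^+ j) - (- w) ^+ j *+ j)).
  apply: fps_cvgZ; first exact: cvg_inv_nat.
  apply: fps_cvgD; first exact: fps_cvg_euler.
  apply: fps_cvgN => k; rewrite fps_coefMn.
  have -> : (fun d => (normalized_derivative (P d) j d *+ j) k) =
            (fun d => normalized_derivative (P d) j d k *+ j).
    by apply/funext => d; rewrite fps_coefMn.
  by apply: cvgMn; exact: IHj.
have := fps_cvgD (fps_cvgM (fps_cvgN Sw) IHj) EX; rewrite addr0 -exprS.
apply: fps_cvg_near; apply: filterS2 P0 PS => d.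
exact: normalized_derivativeS.
Qed.

(** By [rev_fps_ffmul], the left-hand side is the quotient of the reversed polynomials
    of the convolution and of the first factor. *)
Lemma ratio_cvg (B : nat -> fps R) (Binf : fps R) : fps_cvg B Binf ->
  fps_cvg (fun d => fps_inv (P d) * \sum_(j < d.+1)
     ((-1) ^+ j * B d j / (d ^_ j)%:R) *: ffact_fps j (P d)) (fps_comp Binf w).
Proof.
move=> BB; pose x j d := normalized_derivative (P d) j d.
pose c j d : R := (-1) ^+ j * B d j * (d%:R ^+ j / (d ^_ j)%:R).
have cC j : c j d @[d --> \oo] --> (-1) ^+ j * Binf j.
  rewrite -[X in _ --> X]mulr1; apply: cvgM; last exact: cvg_expn_ffact.
  by apply: cvgM; [exact: cvg_cst | exact: BB].
have H := cvg_sum_low cC normalized_derivative_cvg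
  (fun j d => @normalized_derivative_vanishes (P d) j d).
rewrite (_ : fps_comp Binf w = fun k =>
  (\sum_(j < k.+1) ((-1) ^+ j * Binf j) *: (- w) ^+ j) k); last first.
  apply/funext => k; rewrite /fps_comp; congr (_ k); apply: eq_bigr => j _.
  by rewrite -[- w]scaleN1r exprZn scalerA mulrAC -expr2 sqrr_sign mul1r.
apply: fps_cvg_near H; near=> d; rewrite mulr_sumr; apply: eq_bigr => j _.
have d0 : (d%:R : R) ^+ j != 0.
  by rewrite expf_neq0 // pnatr_eq0 -lt0n; near: d; exact: nbhs_infty_gt.
rewrite /normalized_derivative -!scalerAr scalerA /c exprVn; congr (_ *: _).
by rewrite -[RHS]mulrA [_ / _ / _ in RHS]mulrAC divff // mul1r.
Unshelve. all: by end_near. Qed.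

End Limit.

(** The series z G(z) - 1 in t = 1/z. *)
Definition moment_fps (m : nat -> R) : fps R := fun n => if n is 0 then 0 else m n.

Lemma inv_binomial_cvg (u : nat -> nat -> R) (v : nat -> R) :
  (forall k, u d k @[d --> \oo] --> v k) ->
  fps_cvg (fun d => inv_binomial (u d)) (inv_binomial v).
Proof.
move=> uv k; apply: cvg_sum_ord => j; apply: cvgM; [exact: cvg_cst | exact: uv].
Qed.

(** The logarithmic derivative of the quotient in [ratio_cvg] is the difference of the
    power sum series of the convolution and of p; its limit D is read off from the
    chain rule and from the equation of the limit of the expansions of q. *)
Lemma ffmul_moment_difference (p q : nat -> {poly R}) (m b : nat -> R) :
  (forall d, (0 < d)%N -> monic_of_degree d (p d)) ->
  (forall d, (0 < d)%N -> monic_of_degree d (q d)) ->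
  (forall n, poly_moment (p d) n @[d --> \oo] --> m n) ->
  b 0%N = 0 ->
  (forall n, (0 < n)%N -> d%:R * (poly_moment (q d) n - 1) @[d --> \oo] --> b n) ->
  let w := moment_fps m in
  exists D : fps R,
    [/\ D 0%N = 0, w * D = euler w * fps_comp (inv_binomial b) w &
      forall n, (0 < n)%N ->
        d%:R * (poly_moment (ffmul d (p d) (q d)) n - poly_moment (p d) n)
        @[d --> \oo] --> D n].
Proof.
move=> pd qd pm b0 qb w.
pose B d := rev_fps d (q d \Po ('X + 1)).
have BA : \forall d \near \oo, - euler (B d) =
    B d * inv_binomial (fun k => d%:R * (poly_moment (q d) k - 1)).
  near=> d; apply: newton_shift; last apply: qd; by near: d; exact: nbhs_infty_gt.
have B1 : \forall d \near \oo, B d 0%N = 1.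
  near=> d; have d0 : (0 < d)%N by near: d; exact: nbhs_infty_gt.
  have [qm sq] := qd d d0; apply: rev_fps0.
    rewrite -polyC1 monicE lead_coef_comp ?size_XaddC //.
    by rewrite (monicP qm) lead_coefXaddC expr1n mulr1.
  by rewrite -polyC1 size_comp_poly2 ?size_XaddC.
have [Binf [BB Binf0 EB]] : exists F : fps R, [/\ fps_cvg B F, F 0%N = 1 &
    - euler F = F * inv_binomial b].
  have m1 d : d%:R * (poly_moment (q d) 0 - 1) = 0 :> R.
    by case: d => [|d]; rewrite ?mul0r // (poly_moment0 _ (qd d.+1 _)) // subrr mulr0.
  apply: (fps_cvg_log_derivative BA B1) => [d|].
    by rewrite /inv_binomial big_ord1 m1 mulr0.
  apply: inv_binomial_cvg => -[|k]; last exact: qb.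
  by apply: cvg_near_cst; near=> d; rewrite m1 b0.
pose P d := rev_fps d (p d).
have P0 : \forall d \near \oo, P d 0%N = 1.
  near=> d; have d0 : (0 < d)%N by near: d; exact: nbhs_infty_gt.
  by have [pmon sp] := pd d d0; exact: rev_fps0.
have PS : \forall d \near \oo, - euler (P d) = P d * poly_power_sums d (p d).
  near=> d; have d0 : (0 < d)%N by near: d; exact: nbhs_infty_gt.
  exact: newton_moments (pd d d0).
have Sw : fps_cvg (fun d => d%:R^-1 *: poly_power_sums d (p d)) w.
  move=> [|n].
    apply: cvg_near_cst; near=> d; by rewrite fps_coefZ mulr0.
  apply: cvg_trans (pm n.+1); apply: near_eq_cvg; near=> d.
  rewrite fps_coefZ /= mulKf // pnatr_eq0 -lt0n; near: d; exact: nbhs_infty_gt.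
have w0 : w 0%N = 0 by [].
have := ratio_cvg P0 PS Sw BB; set Rf := (X in fps_cvg X); move=> RC.
have Rinf0 : fps_comp Binf w 0%N = 1 by rewrite fps_comp_coef0.
pose D := - euler (fps_comp Binf w) * fps_inv (fps_comp Binf w).
have RD : fps_comp Binf w * D = - euler (fps_comp Binf w).
  by rewrite /D mulrCA fps_mulV // mulr1.
exists D; split.
- by rewrite /D fps_coef0M fps_coefN /euler mulr0n oppr0 mul0r.
- apply: (fps_mulI Rinf0); rewrite mulrCA RD mulrN euler_comp // -mulrN -fps_compN EB.
  by rewrite fps_compM // mulrCA.
have DC : fps_cvg (fun d => - euler (Rf d) * fps_inv (Rf d)) D.
  by apply: fps_cvgM; [apply: fps_cvgN; exact: fps_cvg_euler | exact: fps_cvg_inv].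
move=> n n0; apply: cvg_trans (DC n); apply: near_eq_cvg.
near=> d; have d0 : (0 < d)%N by near: d; exact: nbhs_infty_gt.
have P1 : P d 0%N = 1 by near: d; exact: P0.
have PSd : - euler (P d) = P d * poly_power_sums d (p d) by near: d; exact: PS.
have RfE : P d * Rf d = rev_fps d (ffmul d (p d) (q d)).
  rewrite /Rf mulrA fps_mulV // mul1r rev_fps_ffmul //.
  by case: (qd d d0) => _ ->.
have fm := ffmul_monic (pd d d0) (qd d d0).
have Rf1 : Rf d 0%N = 1.
  have := rev_fps0 fm.1 fm.2.
  by rewrite -RfE fps_coef0M P1 mul1r.
have := newton_moments d0 fm; rewrite -RfE => Nm.
set S' := poly_power_sums d (ffmul _ _ _) in Nm.
(* The logarithmic derivative of a quotient is the difference of those of its terms. *)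
have RS : - euler (Rf d) = Rf d * (S' - poly_power_sums d (p d)).
  apply: (fps_mulI P1); move: Nm; rewrite eulerM opprD -[- (_ * Rf d)]mulNr PSd.
  set S := poly_power_sums d (p d) => E.
  have -> : P d * (Rf d * (S' - S)) = P d * Rf d * S' - P d * S * Rf d by ring.
  by rewrite -E; ring.
rewrite RS mulrAC fps_mulV // mul1r fps_coefB /S' /poly_power_sums.
by case: n n0 => // n _; rewrite mulrBr.
Unshelve. all: by end_near. Qed.

End MulLimit.

(** * Laurent series in 1/z *)

(** The algebra behind [lcomp_theta_lderiv].  There theta is z^n times (1 + w) V in
    t = 1/z, with w V = X = t^n, so V stands for t^n / w; Ew and EV are the images of
    w and V under t d/dt.  The factor w^2 clears the denominators of theta'. *)
Lemma theta_identity (K : comNzRingType) (n : nat) (w C D V X Ew EV : K) :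
  w * V = X -> w * EV = X *+ n - Ew * V -> w * D = Ew * C ->
  w * (w * (w * C * ((1 + w) * V *+ n - (Ew * V + (1 + w) * EV)))) =
  w * (w * (X * D)).
Proof.
move=> wV wEV wD.
have -> : w * (w * (w * C * ((1 + w) * V *+ n - (Ew * V + (1 + w) * EV)))) =
  w * w * C * ((1 + w) * (w * V) *+ n - (Ew * (w * V) + (1 + w) * (w * EV))).
  by ring.
have -> : w * (w * (X * D)) = X * w * (w * D) by ring.
rewrite wD wEV wV.
have -> : w * w * C * ((1 + w) * X *+ n - (Ew * X + (1 + w) * (X *+ n - Ew * V))) =
  w * C * Ew * ((1 + w) * (w * V) - w * X) by ring.
by rewrite wV; ring.
Qed.

Section LaurentTails.
Variable R : realType.
Implicit Types (f g : int -> R) (F G H : fps R) (N M : int) (n : nat).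

Definition laurent_le N f := forall k, N < k -> f k = 0.

(** The coefficients of z^N, z^(N - 1), ...; for f of degree at most N, this is z^- N f
    as a power series in 1/z, and it turns products of Laurent series into products
    of power series. *)
Definition coefs_from N f : fps R := fun i => f (N - i%:Z).

(** The power series F at t = 1/z. *)
Definition of_fps F : int -> R := fun k => if k <= 0 then F `|k|%N else 0.

Lemma laurent_le_is_laurent N f : laurent_le N f -> is_laurent f.
Proof. by exists N. Qed.

Lemma coefs_from_inj N f g :
  laurent_le N f -> laurent_le N g -> coefs_from N f = coefs_from N g -> f = g.
Proof.
move=> fN gN fg; apply/funext => k; have [Nk|kN] := ltP N k; first by rewrite fN ?gN.
have := congr1 (fun F : fps R => F `|N - k|%N) fg; rewrite /coefs_from.
by rewrite (_ : N - _ = k) //; lia.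
Qed.

Lemma coefs_from_lmul N M f g : laurent_le N f -> laurent_le M g ->
  coefs_from (N + M) (lmul f g) = coefs_from N f * coefs_from M g.
Proof. by move=> fN gM; apply/funext => n; exact: lmulE. Qed.

Lemma laurent_le_lmul N M f g : laurent_le N f -> laurent_le M g ->
  laurent_le (N + M) (lmul f g).
Proof. by move=> fN gM k; exact: lmul_eq0. Qed.

Lemma of_fps_le n F : laurent_le n (of_fps F).
Proof. by move=> k nk; rewrite /of_fps ifF //; lia. Qed.

Lemma of_fps_le0 F : laurent_le 0 (of_fps F).
Proof. exact: (@of_fps_le 0%N F). Qed.

Lemma coefs_from_of_fps n F : coefs_from n (of_fps F) = fps_X R ^+ n * F.
Proof.
apply/funext => i; rewrite /coefs_from /of_fps fps_coefXnM.
by have [ni|ni] := ltnP i n; [rewrite ifF //; lia | rewrite ifT; [congr F; lia | lia]].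
Qed.

Lemma coefs_from0_of_fps F : coefs_from 0 (of_fps F) = F.
Proof. by have := coefs_from_of_fps 0%N F; rewrite expr0 mul1r. Qed.

Lemma lone_of_fps : lone R = of_fps 1.
Proof.
apply/funext => k; rewrite /lone /of_fps fps_coef1.
by case: ifP => k0; [congr (_%:R); congr nat_of_bool; lia | rewrite gt_eqF //; lia].
Qed.

Lemma lmul_of_fps F G : lmul (of_fps F) (of_fps G) = of_fps (F * G).
Proof.
apply: (@coefs_from_inj (0 + 0)).
- exact: laurent_le_lmul (@of_fps_le0 _) (@of_fps_le0 _).
- exact: (@of_fps_le0 _).
- by rewrite (coefs_from_lmul (@of_fps_le0 _) (@of_fps_le0 _)) addr0 !coefs_from0_of_fps.
Qed.

Lemma cauchy_series_of_fps (m : nat -> R) :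
  cauchy_series m = of_fps (fps_X R * (m : fps R)).
Proof.
by apply/funext => -[[|n]|n]; rewrite /of_fps /= ?fps_coefXM.
Qed.

Lemma of_fps_X : of_fps (fps_X R) = zinv R.
Proof.
apply/funext => k; rewrite /of_fps /zinv /fps_X.
case: ifP => k0; last by rewrite gt_eqF //; lia.
by congr (_%:R); congr nat_of_bool; lia.
Qed.

Lemma of_fps_inj : injective of_fps.
Proof. by move=> F G FG; rewrite -(coefs_from0_of_fps F) FG coefs_from0_of_fps. Qed.

Lemma of_fpsB F G : of_fps (F - G) = of_fps F - of_fps G.
Proof.
apply/funext => k; rewrite -[RHS]/(of_fps F k - of_fps G k) /of_fps.
by case: ifP; rewrite ?subr0.
Qed.

(** Since d/dz = - t^2 d/dt, applying d/dz to z^n F(1/z) gives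
    z^n t (n F - t F'(t)) at t = 1/z. *)
Lemma coefs_from_lderiv n f : laurent_le n f ->
  coefs_from n (lderiv f) = fps_X R * (coefs_from n f *+ n - euler (coefs_from n f)).
Proof.
move=> fn; apply/funext => i; rewrite fps_coefXM /coefs_from /lderiv.
case: i => [|i]; first by rewrite subr0 fn ?mulr0 //; lia.
rewrite (_ : n%:Z - i.+1%:Z + 1 = n%:Z - i%:Z); last by lia.
by rewrite fps_coefB fps_coefMn /euler intrB mulrBl !mulr_natl.
Qed.

Lemma lderiv_le n f : laurent_le n f -> laurent_le n (lderiv f).
Proof. by move=> fn k nk; rewrite /lderiv fn ?mulr0 //; lia. Qed.

(** A Cauchy series only involves the powers f^(-n-1), so composing it with f is
    composing a power series with H = 1/f. *)
Lemma lcomp_of_fps (u : nat -> R) (f : int -> R) H : H 0%N = 0 ->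
  (forall m, lexp f (Negz m) = of_fps (H ^+ m.+1)) ->
  lcomp (cauchy_series u) f = of_fps (fps_comp (fps_X R * (u : fps R)) H).
Proof.
move=> H0 fH; apply/funext => k; rewrite /lcomp.
have [k0|k0] := ltP 0 k.
  rewrite of_fps_le0 //; apply: fsbig1 => -[j|j] _; first by rewrite mul0r.
  by rewrite fH of_fps_le0 ?mulr0.
have [m ->] : exists m, k = - Posz m by exists `|k|%N; lia.
pose r := [seq Negz i | i <- iota 0 m].
rewrite (fsbigE r); first last.
- move=> [j|j] _ jr; first by rewrite mul0r.
  rewrite fH /of_fps ifT; last by lia.
  rewrite vanishes_belowX ?mulr0 // abszN absz_nat ltnS leqNgt; apply: contra jr => jm.
  by apply/mapP; exists j => //; rewrite mem_iota.
- by [].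
- by rewrite map_inj_uniq ?iota_uniq // => i j [].
rewrite big_map (_ : iota 0 m = index_iota 0 m) ?big_mkord; last first.
  by rewrite /index_iota subn0.
rewrite /of_fps ifT; last by lia.
rewrite abszN absz_nat /fps_comp fps_coef_sum big_ord_recl fps_coefZ fps_coefXM mul0r add0r.
apply: eq_big => [i|i _]; first by rewrite in_setT.
by rewrite fH fps_coefZ fps_coefXM /of_fps ifT ?abszN //; lia.
Qed.

Lemma fps_X_exp_lreg n : GRing.lreg (fps_X R ^+ n).
Proof. exact: lregX (@fps_X_lreg R). Qed.

Lemma euler_X_exp n : euler (fps_X R ^+ n) = fps_X R ^+ n *+ n.
Proof.
apply: (@fps_X_lreg R); rewrite /= euler_exp mulrnAr; congr (_ * _ *+ _).
by apply/funext => -[|[|k]]; rewrite /euler // mul0rn.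
Qed.

Section Theta.
Variables (m : nat -> R) (w : fps R).
Hypothesis m0 : m 0%N = 1.
Hypothesis wE : forall n, w n = if n is 0 then 0 else m n.
Hypothesis w_neq0 : w <> 0.

Let th := ldiv (cauchy_series m) (cauchy_series m - zinv R).

(** In terms of w = z G - 1, theta is the quotient (1 + w) / w.  As the order of w is
    unknown, 1/w is represented by V = t^n / w for some large enough n. *)
Lemma theta_coefs : exists n (V : fps R),
  [/\ laurent_le n th, w * V = fps_X R ^+ n & coefs_from n th = (1 + w) * V].
Proof.
have mE : (m : fps R) = 1 + w.
  by apply/funext => -[|k]; rewrite fps_coefD wE fps_coef1 ?add0r ?addr0.
have GE : cauchy_series m = of_fps (fps_X R * (1 + w)).
  by rewrite cauchy_series_of_fps mE.
have GzE : cauchy_series m - zinv R = of_fps (fps_X R * w).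
  by rewrite GE -of_fps_X -of_fpsB mulrDr mulr1 addrAC subrr add0r.
have Gz0 : of_fps (fps_X R * w) <> 0.
  move=> E; apply: w_neq0; apply: (@fps_X_lreg R); rewrite mulr0.
  apply: of_fps_inj; rewrite E; apply/funext => k; rewrite /of_fps.
  by case: ifP.
have GzL := laurent_le_is_laurent (@of_fps_le0 (fps_X R * w)).
have [[N VN] GV] := linvP GzL Gz0.
rewrite /th /ldiv GzE GE; set V := linv _ in VN GV *.
pose n := `|N|%N; have Vn : laurent_le n.+1 V by move=> k nk; apply: VN; lia.
pose V' := coefs_from n.+1 V.
have thX : coefs_from n.+1 (lmul (of_fps (fps_X R * (1 + w))) V) = fps_X R * ((1 + w) * V').
  have := coefs_from_lmul (@of_fps_le0 (fps_X R * (1 + w))) Vn.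
  by rewrite add0r coefs_from0_of_fps mulrA.
exists n, V'; split.
- move=> k nk; have [nk1|kn1] := ltP (n.+1 : int) k.
    by apply: (laurent_le_lmul (@of_fps_le0 _) Vn); rewrite add0r.
  have := congr1 (fun F : fps R => F 0%N) thX.
  by rewrite fps_coefXM /coefs_from subr0 (_ : k = n.+1) //; lia.
- have := coefs_from_lmul (@of_fps_le0 (fps_X R * w)) Vn.
  rewrite GV add0r coefs_from0_of_fps lone_of_fps coefs_from_of_fps mulr1 exprS -mulrA.
  by move/(@fps_X_lreg R) ->.
- apply/funext => i; have := congr1 (fun F : fps R => F i.+1) thX.
  by rewrite fps_coefXM /coefs_from => <-; congr (lmul _ _ _); lia.
Qed.

Lemma w_lreg : GRing.lreg w.
Proof.
have [n [V [_ wV _]]] := theta_coefs.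
move=> F G FG; apply: (@fps_X_exp_lreg n); rewrite -wV /=.
by rewrite ![w * V]mulrC -!mulrA FG.
Qed.

Let h := fps_comp (fps_geom R) w.

Lemma linv_theta : linv th = of_fps h.
Proof.
have [n [V [thn wV thV]]] := theta_coefs.
have w0 : w 0%N = 0 by rewrite wE.
apply: linv_unique.
- exact: laurent_le_is_laurent thn.
- move=> th0; have : (1 + w) * V = 0 by rewrite -thV th0.
  move=> E; have : fps_X R ^+ n = 0.
    have /(_ V 0) H := fps_mulI (fps_coef01D w0).
    by rewrite -wV H ?mulr0.
  move=> /(congr1 (fun F : fps R => F n)) /eqP.
  by rewrite -[_ ^+ n]mulr1 fps_coefXnM ltnn subnn fps_coef1 eqxx oner_eq0.
- exact: laurent_le_is_laurent (@of_fps_le0 _).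
- apply: (@coefs_from_inj (n%:Z + 0)).
  + exact: laurent_le_lmul thn (@of_fps_le0 _).
  + by rewrite addr0 lone_of_fps; exact: of_fps_le.
  + rewrite (coefs_from_lmul thn (@of_fps_le0 _)) addr0 coefs_from0_of_fps lone_of_fps.
    by rewrite coefs_from_of_fps mulr1 thV mulrAC geom_compE.
Qed.

Lemma lexp_theta k : lexp th (Negz k) = of_fps (h ^+ k.+1).
Proof.
rewrite /lexp linv_theta; elim: k => [|k IHk].
  by rewrite /= lone_of_fps lmul_of_fps mulr1 expr1.
by rewrite iterS IHk lmul_of_fps -exprS.
Qed.

(** The composite is \sum_n a_n w^(n+1) with a = [inv_binomial u], by [fps_comp_geom];
    multiplying by theta' = - w'(z) / w^2 gives the Laurent series whose coefficients
    satisfy the equation of D. *)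
Lemma lcomp_theta_lderiv (u : nat -> R) (D : fps R) :
  w * D = euler w * fps_comp (inv_binomial u) w ->
  lmul (lcomp (cauchy_series u) th) (lderiv th) = cauchy_series D.
Proof.
move=> wD; have w0 : w 0%N = 0 by rewrite wE.
have h0 : h 0%N = 0 by rewrite /h fps_comp_coef0 /fps_geom fps_coef0M mul0r.
have geom0 : fps_geom R 0%N = 0 by rewrite /fps_geom fps_coef0M mul0r.
rewrite (lcomp_of_fps u h0 lexp_theta) /h fps_compA // fps_comp_geom fps_compM //.
rewrite fps_comp_X // cauchy_series_of_fps; set C := fps_comp _ w in wD *.
have [n [V [thn wV thV]]] := theta_coefs.
apply: (@coefs_from_inj (0 + n%:Z)).
- exact: laurent_le_lmul (@of_fps_le0 _) (lderiv_le thn).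
- by rewrite add0r; exact: of_fps_le.
- rewrite (coefs_from_lmul (@of_fps_le0 _) (lderiv_le thn)).
  rewrite coefs_from0_of_fps add0r coefs_from_of_fps.
  rewrite (coefs_from_lderiv thn) thV [LHS]mulrCA [RHS]mulrCA; congr (_ * _).
  (* The product rule for w V = t^n. *)
  have EV : w * euler V = fps_X R ^+ n *+ n - euler w * V.
    by have := congr1 (@euler R) wV; rewrite eulerM euler_X_exp => <-; ring.
  (* Multiplied by w^2, the identity involves V only through w V = t^n. *)
  apply: w_lreg; apply: w_lreg; rewrite /= eulerM eulerD euler1 add0r.
  exact: theta_identity.
Qed.

End Theta.
End LaurentTails.

(** * The Kreweras complement and the free cumulants of the Dirac mass at 1 *)

Section Kreweras.
Variable n : nat.
Implicit Types (P : {set {set 'I_n}}) (V : {set 'I_n}).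

Definition one_block : {set {set 'I_n}} := [set [set: 'I_n]]%SET.
Definition singletons : {set {set 'I_n}} := [set [set i] | i : 'I_n]%SET.

Lemma partition_setT P : finset.partition P [set: 'I_n] ->
  ([set: 'I_n] \in P)%SET -> P = one_block.
Proof.
move=> /and3P [_ triP P0] TP; apply/setP => W; rewrite inE.
apply/idP/eqP => [WP|->//]; have /set0Pn [x xW] : W != finset.set0.
  by apply: contraNneq P0 => <-.
by rewrite -(def_pblock triP WP xW) (def_pblock triP TP) ?inE.
Qed.

Lemma one_block_NC : (0 < n)%N -> one_block \in NC n.
Proof.
move=> n0; rewrite inE; apply/andP; split.
  rewrite /finset.partition /one_block finset.cover1 eqxx finset.trivIset1 /=.
  by rewrite inE eq_sym -card_gt0 cardsT card_ord.
apply/forall_inP => V /set1P ->; apply/forall_inP => W /set1P ->.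
by do 4 (apply/forall_inP => ? _); rewrite eqxx implybT.
Qed.

Lemma singletons_NC : singletons \in NC n.
Proof.
rewrite inE; apply/andP; split.
  apply/and3P; split.
  - apply/eqP/setP => x; rewrite inE; apply/bigcupP; exists [set x]%SET.
      exact: imset_f.
    exact: set11.
  - apply/finset.trivIsetP => _ _ /imsetP [i _ ->] /imsetP [j _ ->] ij.
    by rewrite disjoints1 inE; apply: contraNneq ij => ->.
  - by apply/imsetP => -[i _ /setP /(_ i)]; rewrite !inE eqxx.
apply/forall_inP => _ /imsetP [i _ ->]; apply/forall_inP => W _.
apply/forall_inP => a /set1P ->; apply/forall_inP => b _.
apply/forall_inP => c /set1P ->; apply/forall_inP => d _.
by apply/implyP => /and3P [ab bc _]; have := ltn_trans ab bc; rewrite ltnn.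
Qed.

Lemma partition_card1 P : finset.partition P [set: 'I_n] ->
  (forall V, V \in P -> #|V| = 1%N) -> P = singletons.
Proof.
move=> /and3P [/eqP covP triP _] P1; apply/setP => V; apply/idP/imsetP.
  by move=> VP; have /eqP/cards1P [x ->] := P1 V VP; exists x.
case=> x _ ->; have xP : x \in finset.cover P by rewrite covP inE.
have /eqP/cards1P [y yE] := P1 _ (pblock_mem xP).
have : x \in finset.pblock P x by rewrite mem_pblock.
by rewrite yE => /set1P ->; rewrite -yE pblock_mem.
Qed.

Lemma next_enum_ord (i : 'I_n) : next (enum 'I_n) i = ordS i.
Proof.
case: n i => [|k] i; first by case: i.
rewrite next_nth mem_enum inE index_enum_ord.
have := size_enum_ord k.+1; case E: (enum 'I_k.+1) => [|y s] //= [ss].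
have y0 : y = ord0.
  by apply/val_inj; have := nth_enum_ord ord0 (ltn0Sn k); rewrite E.
have -> : nth y s i = nth y (enum 'I_k.+1) i.+1 by rewrite E.
apply/val_inj => /=; have [ik|ki] := ltnP i.+1 k.+1.
  by rewrite nth_enum_ord // modn_small.
rewrite nth_default ?size_enum_ord // y0 /=.
have -> : i.+1 = k.+1 by have := ltn_ord i; lia.
by rewrite modnn.
Qed.

Lemma block_perm_one_block : finset.partition one_block [set: 'I_n] ->
  block_perm one_block = perm (@ordS_inj n).
Proof.
move=> Ppart; apply/permP => i; rewrite block_permE // permE.
case/and3P: Ppart => _ tri _.
rewrite (def_pblock tri (set11 _)) ?inE //.
by rewrite (eq_enum (B := 'I_n)) ?next_enum_ord // => x; rewrite !inE.
Qed.

Lemma porbits1 : porbits (1 : 'S_n)%g = singletons.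
Proof.
apply: eq_imset => i; apply/setP => x; rewrite inE.
apply/idP/eqP => [/porbitP [k ->]|->]; last exact: porbit_id.
by rewrite expg1n perm1.
Qed.

(** If every cycle of the Kreweras complement is a fixed point, the permutation of P
    is the full cycle (1 2 ... n); its cycles are the blocks of P, so P has one block. *)
Lemma kreweras_card1 P : (0 < n)%N -> finset.partition P [set: 'I_n] ->
  (forall V, V \in kreweras P -> #|V| = 1%N) -> P = one_block.
Proof.
move=> n0 Ppart P1; case/and3P: (Ppart) => /eqP covP triP _.
have sigma1 : (perm (@ordS_inj n) * (block_perm P)^-1)%g = 1%g.
  apply/permP => i; rewrite perm1; set s := (_ * _)%g.
  have sP : porbit s i \in kreweras P by exact: imset_f.
  have /eqP/cards1P [x xE] := P1 _ sP.
  have := mem_porbit s 1 i; have := porbit_id s i.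
  by rewrite xE expg1 => /set1P -> /set1P.
have bE : block_perm P = perm (@ordS_inj n).
  by apply/esym/eqP; rewrite eq_mulgV1 sigma1.
have pS i : finset.pblock P (ordS i) = finset.pblock P i.
  apply: same_pblock => //.
  have := block_permE i Ppart; rewrite bE permE => ->.
  by rewrite -mem_enum mem_next mem_enum mem_pblock covP inE.
pose i0 := Ordinal n0.
have pk k (kn : (k < n)%N) : finset.pblock P (Ordinal kn) = finset.pblock P i0.
  elim: k kn => [|k IHk] kn; first by congr finset.pblock; apply/val_inj.
  rewrite -(IHk (ltnW kn)) -[RHS]pS; congr finset.pblock; apply/val_inj => /=.
  by rewrite modn_small.
apply: partition_setT => //.
suff <- : finset.pblock P i0 = [set: 'I_n]%SET by rewrite pblock_mem // covP inE.
apply/setP => -[k kn]; rewrite inE -(pk k kn).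
by rewrite mem_pblock covP inE.
Qed.

End Kreweras.

Section FreeCumulantsOne.
Variable R : comNzRingType.

Definition cumulant_one (k : nat) : R := (k == 1)%:R.

Lemma block_prod_one n (P : {set {set 'I_n}}) :
  block_prod cumulant_one P = [forall V in P, #|V| == 1%N]%:R.
Proof.
rewrite /block_prod; case: (boolP [forall V in P, _]) => [/forall_inP P1|].
  by apply: big1 => V VP; rewrite /cumulant_one P1.
rewrite negb_forall_in => /exists_inP [V VP V1].
by rewrite (bigD1 V) //= /cumulant_one (negbTE V1) mul0r.
Qed.

Lemma block_prod_one_NC n (P : {set {set 'I_n}}) : P \in NC n ->
  block_prod cumulant_one P = (P == singletons n)%:R.
Proof.
rewrite inE => /andP [Ppart _]; rewrite block_prod_one; congr (_%:R); congr nat_of_bool.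
apply/forall_inP/eqP => [P1|->]; last by move=> _ /imsetP [i _ ->]; rewrite cards1.
by apply: partition_card1 => // V /P1 /eqP.
Qed.

(** The moment-cumulant relations are triangular: the partition with one block
    isolates the n-th cumulant, and the others involve smaller blocks. *)
Lemma free_cumulant_unique (m r : nat -> R) :
  (forall n, (0 < n)%N -> m n = \sum_(P in NC n) block_prod r P) ->
  forall n, (0 < n)%N -> free_cumulant m n = r n.
Proof.
move=> mr; elim/ltn_ind => n IHn n0.
have := moment_free_cumulant m n0; rewrite (mr n n0).
have full u : block_prod u (one_block n) = u n :> R.
  by rewrite /block_prod /one_block big_set1 cardsT card_ord.
have low : \sum_(P in NC n | P != one_block n) block_prod r P =
           \sum_(P in NC n | P != one_block n) block_prod (free_cumulant m) P.
  apply: eq_bigr => P /andP []; rewrite inE => /andP [Ppart _] Pfull.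
  apply: eq_bigr => V VP; rewrite IHn //.
    rewrite -[X in (_ < X)%N]card_ord -cardsT; apply: proper_card.
    rewrite finset.properEneq finset.subsetT andbT.
    by apply: contra_neq Pfull => VT; apply: partition_setT => //; rewrite -VT.
  case/and3P: Ppart => _ _ P0; rewrite card_gt0.
  by apply: contraNneq P0 => <-.
by rewrite !(bigD1 _ (one_block_NC n0)) /= low !full => /addIr.
Qed.

Lemma free_cumulant_one n : (0 < n)%N -> free_cumulant (fun=> 1 : R) n = (n == 1)%:R.
Proof.
move=> n0; rewrite (free_cumulant_unique (r := cumulant_one)) // => k _.
rewrite (bigD1 (singletons k)) ?singletons_NC //= block_prod_one_NC ?singletons_NC //.
rewrite eqxx big1 ?addr0 // => P /andP [PNC Ps].
by rewrite block_prod_one_NC // (negbTE Ps).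
Qed.

(** The cumulants of the Dirac mass at 1 kill every partition whose Kreweras complement
    has a block with two elements, and only the partition with one block survives. *)
Lemma kreweras_sum (r : nat -> R) n : (0 < n)%N ->
  \sum_(P in NC n) block_prod r P *
    block_prod (free_cumulant (fun=> 1 : R)) (kreweras P) = r n.
Proof.
move=> n0.
have cE (P : {set {set 'I_n}}) : finset.partition P [set: 'I_n] ->
    block_prod (free_cumulant (fun=> 1 : R)) (kreweras P) =
    [forall V in kreweras P, #|V| == 1%N]%:R.
  move=> Ppart; rewrite -block_prod_one; apply: eq_bigr => V VP.
  rewrite free_cumulant_one // card_gt0; apply/set0Pn.
  by case/imsetP: VP => i _ ->; exists i; exact: porbit_id.
rewrite (bigD1 (one_block n)) ?one_block_NC //= big1 ?addr0.
  have := one_block_NC n0; rewrite inE => /andP [Ppart _].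
  rewrite cE // /block_prod /one_block big_set1 cardsT card_ord.
  rewrite -/(one_block n) (_ : [forall V in _, _] = true) ?mulr1 //.
  apply/forall_inP => V; rewrite /kreweras block_perm_one_block // mulgV porbits1.
  by move=> /imsetP [i _ ->]; rewrite cards1.
move=> P /andP []; rewrite inE => /andP [Ppart _] Pfull; rewrite cE //.
case: (boolP [forall V in _, _]) => [/forall_inP P1|_]; last by rewrite mulr0.
by case/eqP: Pfull; apply: kreweras_card1 => // V /P1 /eqP.
Qed.

End FreeCumulantsOne.

(** * Moments and functionals *)

Section Measures.
Variable R : realType.
Notation distr := (probability (measurableTypeR R) R).

Lemma moment0 (mu : distr) : moment mu 0 = 1.
Proof.
rewrite /moment /Rintegral.
under eq_integral do rewrite expr0.
by rewrite integral_cst // mul1e [X in fine X](@probability_setT _ _ _ mu).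
Qed.

Lemma same_measure_moment (mu : distr) (a : R) :
  same_measure mu (\d_a) -> moment mu = (fun n => a ^+ n).
Proof.
move=> muE; apply/funext => n; rewrite /moment /Rintegral.
rewrite (@eq_measure_integral _ (measurableTypeR R) R setT
  (@dirac _ (measurableTypeR R) a R) mu); last first.
  by move=> A mA _; exact: muE.
rewrite integral_dirac //; last first.
  by apply/measurable_EFinP; exact: exprn_measurable.
by rewrite diracT mul1e.
Qed.

Lemma dirac_finite_moments (a : R) : finite_moments (@dirac _ (measurableTypeR R) a R).
Proof.
move=> n; apply/integrableP; split.
  by apply/measurable_EFinP; exact: exprn_measurable.
rewrite integral_dirac //; last first.
  by apply: measurableT_comp => //; apply/measurable_EFinP; exact: exprn_measurable.
by rewrite diracT mul1e /= ltry.
Qed.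

Definition scalar_of (c : nat -> R) (f : {poly R}) : R := \sum_(i < size f) f`_i * c i.

Lemma scalar_of_wide c (f : {poly R}) n :
  (size f <= n)%N -> scalar_of c f = \sum_(i < n) f`_i * c i.
Proof.
move=> fn; rewrite /scalar_of (big_ord_widen _ (fun i => f`_i * c i) fn) big_mkcond.
apply: eq_bigr => i _; case: ifPn => //; rewrite -leqNgt => ?.
by rewrite nth_default ?mul0r.
Qed.

Lemma scalar_of_is_linear c : linear (scalar_of c : {poly R} -> R^o).
Proof.
move=> a f g; pose n := maxn (size f) (size g).
have afg : (size (a *: f + g)%R <= n)%N.
  apply: leq_trans (size_polyD _ _) _; rewrite geq_max leq_maxr andbT.
  by apply: leq_trans (size_scale_leq _ _) _; rewrite leq_maxl.
rewrite (scalar_of_wide c afg) (scalar_of_wide c (leq_maxl _ _ : size f <= n)%N).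
rewrite (scalar_of_wide c (leq_maxr _ _ : size g <= n)%N) scaler_sumr -big_split /=.
by apply: eq_bigr => i _; rewrite coefD coefZ mulrDl -mulrA.
Qed.

HB.instance Definition _ c := GRing.isLinear.Build R {poly R} R^o *:%R
  (scalar_of c) (scalar_of_is_linear c).

Lemma scalar_of_Xn c n : scalar_of c 'X^n = c n.
Proof.
rewrite (@scalar_of_wide c _ n.+1) ?size_polyXn // big_ord_recr /= coefXn eqxx mul1r.
by rewrite big1 ?add0r // => i _; rewrite coefXn ltn_eqF ?mul0r.
Qed.

Lemma exists_functional (c : nat -> R) :
  exists L : {scalar {poly R}}, forall n, L 'X^n = c n.
Proof. by exists (scalar_of c : {scalar {poly R}}) => n; exact: scalar_of_Xn. Qed.

End Measures.

(** * The infinitesimal distribution of the convolution *)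

Theorem corollary4p11 (R : realType) (p q : nat -> {poly R})
    (mu nu : probability (measurableTypeR R) R)
    (mu' nu' : {scalar {poly R}})
    (p_real : forall d, (0 < d)%N -> real_rooted d (p d))
    (q_real : forall d, (0 < d)%N -> real_rooted d (q d))
    (p_mu : has_infinitesimal_distribution p mu mu')
    (q_nu : has_infinitesimal_distribution q nu nu')
    (mu_neq : ~ same_measure mu (\d_(0 : R)))
    (nu_eq : same_measure nu (\d_(1 : R))) :
  exists (gamma : probability (measurableTypeR R) R)
         (gamma' : {scalar {poly R}}),
    [/\ is_free_mul mu nu gamma,
        has_infinitesimal_distribution
          (fun d => ffmul d (p d) (q d)) gamma gamma'
      & G_func gamma' =
          G_func mu' + lmul (lcomp (G_func nu') (theta mu)) (lderiv (theta mu))].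
Proof.
have [pd mu_det pm mu'1 mu'X] := p_mu; have [qd nu_det qm nu'1 nu'X] := q_nu.
have nu1 : moment nu = fun=> 1.
  by rewrite (same_measure_moment nu_eq); apply/funext => n; rewrite expr1n.
pose w := moment_fps (moment mu); pose u n := nu' 'X^n.
have [||D [D0 wD pqD]] := @ffmul_moment_difference R p q (moment mu) u pd qd pm.
- by rewrite /u expr0.
- by move=> n n0; have := nu'X n n0; rewrite nu1.
have w_neq0 : w <> 0.
  move=> w0; apply: mu_neq => A mA; apply/esym.
  apply: (mu_det.2 _ (@dirac_finite_moments R 0)) => // n.
  rewrite (@same_measure_moment R _ 0) //.
  case: n => [|n]; first by rewrite moment0 expr0.
  by have := congr1 (fun F : fps R => F n.+1) w0; rewrite /w /= expr0n => ->.
(* The infinitesimal functional of the convolution is mu' corrected by D. *)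
have [gamma' gX] := exists_functional (fun n => mu' 'X^n + D n).
exists mu, gamma'; split.
- split=> //.
    have neg : [set x : R | x < 0] = [set` `]-oo, (0 : R)[].
      by apply/seteqP; split => x /=; rewrite in_itv.
    rewrite nu_eq; last by rewrite neg; exact: measurable_itv.
    by rewrite diracE memNset //= ltr10.
  by move=> n n0; rewrite nu1 kreweras_sum.
- have diffD n : (0 < n)%N ->
      d%:R * (poly_moment (ffmul d (p d) (q d)) n - moment mu n) @[d --> \oo] --> gamma' 'X^n.
    move=> n0; rewrite gX addrC.
    have -> : (fun d => d%:R * (poly_moment (ffmul d (p d) (q d)) n - moment mu n)) =
      (fun d => d%:R * (poly_moment (ffmul d (p d) (q d)) n - poly_moment (p d) n)
              + d%:R * (poly_moment (p d) n - moment mu n)).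
      by apply/funext => d; rewrite -mulrDr addrA subrK.
    by apply: cvgD; [exact: pqD | exact: mu'X].
  split=> //.
  + by move=> d d0; apply: ffmul_monic; [exact: pd | exact: qd].
  + case=> [|n].
      rewrite moment0; apply: cvg_near_cst; near=> d.
      have d0 : (0 < d)%N by near: d; exact: nbhs_infty_gt.
      by apply: (@poly_moment0 R d) => //; apply: ffmul_monic; [exact: pd | exact: qd].
    (* The moments converge because their differences with the limit are O(1/d). *)
    have H : d%:R^-1 * (d%:R * (poly_moment (ffmul d (p d) (q d)) n.+1 - moment mu n.+1))
        + moment mu n.+1 @[d --> \oo] --> (0 * gamma' 'X^(n.+1) + moment mu n.+1 : R).
      apply: cvgD; last exact: cvg_cst.
      by apply: cvgM; [exact: cvg_inv_nat | exact: diffD].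
    move: H; rewrite mul0r add0r; apply: cvg_trans; apply: near_eq_cvg.
    near=> d; rewrite mulKf ?subrK // pnatr_eq0 -lt0n.
    by near: d; exact: nbhs_infty_gt.
  + by have := gX 0%N; rewrite expr0 mu'1 D0 addr0.
- have := lcomp_theta_lderiv (moment0 mu) (fun n => erefl _ : w n = _) w_neq0 wD.
  rewrite /G_func /theta /G_meas => ->.
  apply/funext => -[k|k]; rewrite fctE /=; first by rewrite addr0.
  exact: gX.
Unshelve. all: by end_near. Qed.
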